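(* Let $Y$ be a rich solid QBF-space on $X$ with quasi-norm constant $C_Y$. Suppose that the analyzing frame $\mathcal F$ possesses property $D(\delta,\nu,Y)$ for some $\delta>0$ with associated covering $\mathcal U=\{U_i\}_{i\in I}$ and phase function $\Gamma$. Then the discretization operator $U_\Phi$ for some $\mathcal U$-PU $\Phi$ is a well-defined bounded operator $U_\Phi:R_{\mathcal F}(Y)\to R_{\mathcal F}(Y)$ and it holds $$\|\mathrm{Id}-U_\Phi\,|\,R_{\mathcal F}(Y)\to R_{\mathcal F}(Y)\|\le\delta\big(\|R_{\mathcal F}|Y\to Y\|+\|M^*_{\mathcal U}|Y\to Y\|\big)C_Y .$$
   Context: Frame setting. $\mathcal H$ is a separable complex Hilbert space (inner product linear in the first argument); $X$ is a $\sigma$-compact locally compact Hausdorff space with a positive Radon measure $\mu$, $\operatorname{supp}\mu=X$. $\mathcal F=\{\varphi_x\}_{x\in X}\subset\mathcal H$ is a Parseval continuous frame: $x\mapsto\varphi_x$ is weakly measurable and $\|f|\mathcal H\|^2=\int_X|\langle f,\varphi_x\rangle|^2\,d\mu(x)$ for all $f\in\mathcal H$. $V_{\mathcal F}f(x)=\langle f,\varphi_x\rangle$; $R_{\mathcal F}(x,y)=\langle\varphi_y,\varphi_x\rangle$. A measurable kernel $K:X\times X\to\mathbb C$ acts by $K(F)(x)=\int_XK(x,y)F(y)\,d\mu(y)$. Weights. For a weight (measurable function) $\nu:X\to[1,\infty)$: $\|F|L_p^\nu\|=\|F\nu|L_p(X,\mu)\|$, $m_\nu(x,y)=\max\{\nu(x)/\nu(y),\nu(y)/\nu(x)\}$;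 $\mathcal A_{m_\nu}$ is the set of measurable $K$ with $\|K|\mathcal A_{m_\nu}\|=\max\{\operatorname{ess\,sup}_x\int|K(x,y)|m_\nu(x,y)d\mu(y),\operatorname{ess\,sup}_y\int|K(x,y)|m_\nu(x,y)d\mu(x)\}<\infty$. $\mathcal H_1^\nu=\{f\in\mathcal H:V_{\mathcal F}f\in L_1^\nu(X)\}$. Frame condition: (a) $\|\varphi_x|\mathcal H\|\le C_B\nu(x)$ for some $C_B>0$ and all $x\in X$; (b) $R_{\mathcal F}\in\mathcal A_{m_\nu}$. By convention $\mathcal F\subset\mathcal H_1^\nu$ is assumed. Function spaces. A QBF-space $Y$ on $X$ is a linear space of ($\mu$-a.e. equivalence classes of) measurable functions on $X$, complete under a quasi-norm with $\|f+g|Y\|\le C_Y(\|f|Y\|+\|g|Y\|)$. It is solid if $f$ measurable, $g\in Y$, $|f|\le|g|$ a.e. imply $f\in Y$, $\|f|Y\|\le\|g|Y\|$; rich if $\chi_K\in Y$ for all compact $K\subset X$. $\mathcal B_{Y,m_\nu}$ is the set of $K\in\mathcal A_{m_\nu}$ bounded $Y\to Y$, $\|K|\mathcal B_{Y,m_\nu}\|=\max\{\|K|\mathcal A_{m_\nu}\|,\|K|Y\to Y\|\}$. Property $F(\nu,Y)$: $\mathcal F$ satisfies (a),(b), $R_{\mathcal F}:Y\to Y$ is continuous, and $R_{\mathcal F}(Y)\hookrightarrow L_\infty^{1/\nu}(X)$ continuously. $R_{\mathcal F}(Y)$ is the image space with the quasi-norm of $Y$; its elements satisfy $F=R_{\mathcal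 F}(F)$, and point evaluations are understood as $F(x)=\int_XR_{\mathcal F}(x,y)F(y)\,d\mu(y)$. Coverings. A covering $\mathcal U=\{U_i\}_{i\in I}$ of $X$ is admissible if it is locally finite (each $x\in X$ has a neighborhood meeting only finitely many $U_i$), each $U_i$ is measurable, relatively compact, with non-void interior, and $\sup_{i}\sharp\{j:U_i\cap U_j\ne\emptyset\}<\infty$. $Q_y=\bigcup_{i:y\in U_i}U_i$. $M_{\mathcal U}(x,y)=\sup_{z\in Q_y}|\langle\varphi_x,\varphi_z\rangle|$, $M^*_{\mathcal U}(x,y)=M_{\mathcal U}(y,x)$. Property $D(\delta,\nu,Y)$ (for a weight $\nu\ge1$): $\mathcal F$ has property $F(\nu,Y)$ and there exist an admissible covering $\mathcal U$ and a phase function $\Gamma:X\times X\to\{z\in\mathbb C:|z|=1\}$ such that, with $\mathrm{osc}_{\mathcal U,\Gamma}(x,y)=\sup_{z\in Q_y}|R_{\mathcal F}(x,y)-\Gamma(y,z)R_{\mathcal F}(x,z)|$ and $\mathrm{osc}^*_{\mathcal U,\Gamma}(x,y)=\mathrm{osc}_{\mathcal U,\Gamma}(y,x)$, the kernels $|R_{\mathcal F}|,\mathrm{osc}_{\mathcal U,\Gamma},\mathrm{osc}^*_{\mathcal U,\Gamma}$ belong to $\mathcal B_{Y,m_\nu}$ and $\|\mathrm{osc}_{\mathcal U,\Gamma}|\mathcal B_{Y,m_\nu}\|<\delta$, $\|\mathrm{osc}^*_{\mathcal U,\Gamma}|\mathcal B_{Y,m_\nu}\|<\delta$. Discretization operator.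 A $\mathcal U$-PU is a family $\Phi=\{\Phi_i\}_{i\in I}$ of measurable functions with $0\le\Phi_i\le1$, $\operatorname{supp}\Phi_i\subset U_i$, $\sum_i\Phi_i\equiv1$ on $X$. With $c_i=\int_X\Phi_i\,d\mu$ and fixed (arbitrarily chosen) points $x_i\in U_i$, $U_\Phi F(x)=\sum_{i\in I}c_iF(x_i)R_{\mathcal F}(x,x_i)$ for $F\in R_{\mathcal F}(Y)$ (pointwise absolute convergence a.e.). ''For some $\mathcal U$-PU $\Phi$'' means for an arbitrarily fixed one. *)

(* Defs.v *)
From HB Require Import structures.
From mathcomp Require Import all_boot all_order all_algebra.
From mathcomp Require Import all_classical all_reals all_analysis.
From mathcomp Require Import ess_sup_inf complex.
Set Implicit Arguments.
Unset Strict Implicit.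
Unset Printing Implicit Defensive.
Import Order.TTheory GRing.Theory Num.Theory.
Import numFieldNormedType.Exports.
Local Open Scope classical_set_scope.
Local Open Scope ring_scope.

Notation borel X := (g_sigma_algebraType (@open X)).

(* The type [R[i]] carries neither a measurable structure nor a Lebesgue
   integral in the library; both are reduced to real and imaginary parts, with
   the usual caveat that the value of [cint] is only meaningful when
   [cintegrable] holds. *)
Section complex_analysis.
Context {R : realType}.

Definition cabs (z : R[i]) : R := Normc.normc z.

Section over_a_measure.
Context {d : measure_display} {T : measurableType d}.
Implicit Types (mu : {measure set T -> \bar R}) (f : T -> R[i]).

Definition cmeasurable f :=
  measurable_fun [set: T] (fun x => complex.Re (f x)) /\
  measurable_fun [set: T] (fun x => complex.Im (f x)).

Definition cintegrable mu f :=
  cmeasurable f /\ (\int[mu]_x (cabs (f x))%:E < +oo)%E.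

Definition cint mu f : R[i] :=
  (fine (\int[mu]_x (complex.Re (f x))%:E)%E +i*
   fine (\int[mu]_x (complex.Im (f x))%:E)%E)%C.

End over_a_measure.

(* Sum of an absolutely summable family over an arbitrary index type, obtained
   like the Lebesgue integral from positive and negative parts. *)
Section sums.
Context {I : choiceType}.

Definition cabs_summable (f : I -> R[i]) :=
  (\esum_(i in [set: I]) (cabs (f i))%:E < +oo)%E.

Definition rsum (g : I -> R) : R :=
  fine (\esum_(i in [set: I]) (Num.max (g i) 0)%:E) -
  fine (\esum_(i in [set: I]) (Num.max (- g i) 0)%:E).

Definition csum (f : I -> R[i]) : R[i] :=
  (rsum (fun i => complex.Re (f i)) +i* rsum (fun i => complex.Im (f i)))%C.

End sums.

End complex_analysis.

Definition sigma_compact (X : topologicalType) :=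
  exists K : nat -> set X, (forall n, compact (K n)) /\ \bigcup_n K n = [set: X].

Section index_space.
Context {R : realType} {X : ptopologicalType}.
Implicit Types (mu : {measure set (borel X) -> \bar R}).

Definition radon mu :=
  [/\ forall K : set X, compact K -> (mu K < +oo)%E,
      forall A : set (borel X), measurable A ->
        mu A = ereal_inf [set mu O | O in [set O : set X | open O /\ A `<=` O]] &
      forall O : set X, open O ->
        mu O = ereal_sup [set mu K | K in [set K : set X | compact K /\ K `<=` O]]].

Definition measure_support mu : set X :=
  [set x | forall O : set X, open O -> O x -> (0 < mu O)%E].

Definition is_weight (nu : borel X -> R) :=
  measurable_fun [set: borel X] nu /\ forall x, 1 <= nu x.

Section coverings.
Context {I : choiceType}.

Definition admissible_covering (U : I -> set (borel X)) :=
  [/\ \bigcup_i U i = [set: X],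
      forall x : X, exists2 V : set X, nbhs x V &
        finite_set [set i | U i `&` V !=set0],
      forall i, [/\ measurable (U i), precompact (U i : set X) &
                    interior (U i : set X) !=set0] &
      exists N : nat, forall i, ([set j | U i `&` U j !=set0] #<= `I_N)%card].

Definition Qset (U : I -> set (borel X)) (y : X) : set X :=
  \bigcup_(i in [set i | U i y]) U i.

(* The support condition is the set-theoretic one: [Phi i] vanishes off [U i].
   The topological closure of the non-vanishing set need not lie in [U i]. *)
Definition partition_of_unity (U : I -> set (borel X)) (Phi : I -> borel X -> R) :=
  [/\ forall i, measurable_fun [set: borel X] (Phi i),
      forall i x, 0 <= Phi i x <= 1,
      forall i x, Phi i x != 0 -> U i x &
      forall x, (\esum_(i in [set: I]) (Phi i x)%:E = 1)%E].

End coverings.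
End index_space.

(* Elements of a QBF-space are a.e. classes; the carrier is represented by the
   set of all representatives, saturated for a.e. equality. *)
Record qbf_space {R : realType} {X : ptopologicalType}
    (mu : {measure set (borel X) -> \bar R}) (CY : R) := QBFSpace {
  qbf_set : set (borel X -> R[i]) ;
  qnorm : (borel X -> R[i]) -> R ;
  qbf_measurable : forall f, qbf_set f -> cmeasurable f ;
  qbf_ae : forall f g, qbf_set f -> cmeasurable g ->
    {ae mu, forall x, f x = g x} -> qbf_set g /\ qnorm g = qnorm f ;
  qbf0 : qbf_set (fun=> 0) ;
  qbfD : forall f g, qbf_set f -> qbf_set g -> qbf_set (fun x => f x + g x) ;
  qbfZ : forall (a : R[i]) f, qbf_set f -> qbf_set (fun x => a * f x) ;
  qnorm_ge0 : forall f, qbf_set f -> 0 <= qnorm f ;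
  qnorm_eq0 : forall f, qbf_set f ->
    qnorm f = 0 <-> {ae mu, forall x, f x = 0} ;
  qnormZ : forall (a : R[i]) f, qbf_set f ->
    qnorm (fun x => a * f x) = cabs a * qnorm f ;
  qnormD : forall f g, qbf_set f -> qbf_set g ->
    qnorm (fun x => f x + g x) <= CY * (qnorm f + qnorm g) ;
  qbf_complete : forall u : nat -> borel X -> R[i],
    (forall n, qbf_set (u n)) ->
    (forall e : R, 0 < e -> exists N : nat, forall m n, (N <= m)%N -> (N <= n)%N ->
       qnorm (fun x => u m x - u n x) < e) ->
    exists2 f, qbf_set f &
      qnorm (fun x => u n x - f x) @[n --> \oo] --> (0 : R) }.

Section kernels.
Context {R : realType} {X : ptopologicalType}.
Variable mu : {measure set (borel X) -> \bar R}.
Implicit Types (K : borel X * borel X -> R[i]) (k : borel X * borel X -> \bar R).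
Implicit Types (nu : borel X -> R) (F : borel X -> R[i]).

Definition kact K F : borel X -> R[i] := fun x => cint mu (fun y => K (x, y) * F y).

Definition mweight nu (p : borel X * borel X) : R :=
  Num.max (nu p.1 / nu p.2) (nu p.2 / nu p.1).

Definition Anorm nu K : \bar R := maxe
  (ess_sup mu (fun x => \int[mu]_y (cabs (K (x, y)) * mweight nu (x, y))%:E))%E
  (ess_sup mu (fun y => \int[mu]_x (cabs (K (x, y)) * mweight nu (x, y))%:E))%E.

Definition in_A nu K := cmeasurable K /\ (Anorm nu K < +oo)%E.

Definition kabs K : borel X * borel X -> R[i] := fun p => (cabs (K p))%:C%C.

(* Suprema of moduli are taken in [\bar R]; they are regarded as genuine kernels
   after discarding a null set on which they may be infinite. *)
Definition ker_of k : borel X * borel X -> R[i] := fun p => (fine (k p))%:C%C.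

Definition ker_finite k := {ae (mu \x mu)%E, forall p, (k p < +oo)%E}.

Definition ker_adj k : borel X * borel X -> \bar R := fun p => k (p.2, p.1).

End kernels.

Section qbf_theory.
Context {R : realType} {X : ptopologicalType}.
Context {mu : {measure set (borel X) -> \bar R}} {CY : R}.
Implicit Types (Y : qbf_space mu CY) (V : set (borel X -> R[i])).
Implicit Types (T : (borel X -> R[i]) -> borel X -> R[i]).
Implicit Types (K : borel X * borel X -> R[i]) (nu : borel X -> R).

Definition solid Y := forall f g, cmeasurable f -> qbf_set Y g ->
  {ae mu, forall x, cabs (f x) <= cabs (g x)} ->
  qbf_set Y f /\ qnorm Y f <= qnorm Y g.

Definition rich Y := forall K : set X, compact K ->
  qbf_set Y (fun x : borel X => (\1_K x : R)%:C%C).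

(* Operators acting on a subspace [V] of [Y] that inherits the quasi-norm. *)
Definition op_bound Y V T (C : R) :=
  forall F, V F -> V (T F) /\ qnorm Y (T F) <= C * qnorm Y F.

Definition bounded_operator Y V T :=
  (forall (a : R[i]) F G, V F -> V G ->
     {ae mu, forall x, T (fun y => a * F y + G y) x = a * T F x + T G x}) /\
  exists C, op_bound Y V T C.

(* Equals [+oo] when [T] is not a bounded map from [V] to [V]. *)
Definition opnorm Y V T : \bar R :=
  ereal_inf [set C%:E | C in [set C | 0 <= C /\ op_bound Y V T C]].

Definition kdefined Y K := forall F, qbf_set Y F ->
  {ae mu, forall x, cintegrable mu (fun y => K (x, y) * F y)}.

Definition kbounded Y K :=
  kdefined Y K /\ exists C, op_bound Y (qbf_set Y) (kact mu K) C.

Definition kopnorm Y K : \bar R := ereal_inf [set C%:E | C in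
  [set C | [/\ 0 <= C, kdefined Y K & op_bound Y (qbf_set Y) (kact mu K) C]]].

Definition in_B Y nu K := in_A mu nu K /\ kbounded Y K.

Definition Bnorm Y nu K : \bar R := maxe (Anorm mu nu K) (kopnorm Y K).

End qbf_theory.

Section frames.
Context {R : realType} {X : ptopologicalType} {H : completeNormedModType R[i]}.
Context {I : choiceType}.
Variables (mu : {measure set (borel X) -> \bar R}) (dot : {dot H for Num.conj}).
Implicit Types (phi : borel X -> H) (nu : borel X -> R).

(* [dot] is linear in its first argument. *)
Definition hilbert_separable :=
  (forall f : H, `|f| ^+ 2 = dot f f) /\
  (exists2 S : set H, countable S & dense S).

Definition hnorm (f : H) : R := complex.Re `|f|.

Definition voice phi (f : H) : borel X -> R[i] := fun x => dot f (phi x).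

Definition parseval_frame phi :=
  (forall f, cmeasurable (voice phi f)) /\
  (forall f, ((hnorm f ^+ 2)%:E = \int[mu]_x (cabs (voice phi f x) ^+ 2)%:E)%E).

Definition in_H1 phi nu (f : H) :=
  cmeasurable (voice phi f) /\
  (\int[mu]_x (cabs (voice phi f x) * nu x)%:E < +oo)%E.

Definition Rker phi : borel X * borel X -> R[i] := fun p => dot (phi p.2) (phi p.1).

Definition frame_condition phi nu :=
  (exists2 CB : R, 0 < CB & forall x, hnorm (phi x) <= CB * nu x) /\
  in_A mu nu (Rker phi).

Definition Mker phi (U : I -> set (borel X)) : borel X * borel X -> \bar R :=
  fun p => ereal_sup [set (cabs (dot (phi p.1) (phi z)))%:E | z in Qset U p.2].

Definition osc phi (U : I -> set (borel X)) (Gamma : X -> X -> R[i]) :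
    borel X * borel X -> \bar R :=
  fun p => ereal_sup
    [set (cabs (Rker phi p - Gamma p.2 z * Rker phi (p.1, z)))%:E
    | z in Qset U p.2].

Section with_space.
Context {CY : R}.
Variables (Y : qbf_space mu CY).

Definition Rspace phi : set (borel X -> R[i]) :=
  [set F | cmeasurable F /\
    exists2 G, qbf_set Y G & {ae mu, forall x, F x = kact mu (Rker phi) G x}].

Definition prop_F phi nu :=
  [/\ frame_condition phi nu,
      kbounded Y (Rker phi) &
      exists C : R, forall F, Rspace phi F ->
        (ess_sup mu (fun x => (cabs (F x) / nu x)%:E) <= (C * qnorm Y F)%:E)%E].

Definition prop_D (delta : R) phi nu (U : I -> set (borel X))
    (Gamma : X -> X -> R[i]) :=
  [/\ prop_F phi nu,
      admissible_covering U,
      forall x y, cabs (Gamma x y) = 1,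
      in_B Y nu (kabs (Rker phi)) &
      forall k, k = osc phi U Gamma \/ k = ker_adj (osc phi U Gamma) ->
        [/\ ker_finite mu k, in_B Y nu (ker_of k) &
            (Bnorm Y nu (ker_of k) < delta%:E)%E]].

(* Point values of [F] in [Rspace] are those of [kact mu (Rker phi) F]. *)
Definition Uterm phi (Phi : I -> borel X -> R) (xs : I -> X)
    (F : borel X -> R[i]) (x : borel X) (i : I) : R[i] :=
  (fine (\int[mu]_y (Phi i y)%:E)%E)%:C%C *
  kact mu (Rker phi) F (xs i) * Rker phi (x, xs i).

Definition Uop phi Phi xs (F : borel X -> R[i]) : borel X -> R[i] :=
  fun x => csum (Uterm phi Phi xs F x).

Definition Uop_defined phi Phi xs := forall F, Rspace phi F ->
  [/\ forall i, (\int[mu]_x (Phi i x)%:E < +oo)%E,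
      forall i, cintegrable mu (fun y => Rker phi (xs i, y) * F y) &
      {ae mu, forall x, cabs_summable (Uterm phi Phi xs F x)}].

End with_space.
End frames.

(* Main.v *)
Require Import Defs.
From HB Require Import structures.
From mathcomp Require Import all_boot all_order all_algebra.
From mathcomp Require Import all_classical all_reals all_analysis.
From mathcomp Require Import ess_sup_inf complex.
From mathcomp Require Import measurable_realfun ring lra.
Import Order.TTheory GRing.Theory Num.Theory.
Import numFieldNormedType.Exports.
Local Open Scope classical_set_scope.
Local Open Scope ring_scope.
Set Implicit Arguments.
Unset Strict Implicit.
Unset Printing Implicit Defensive.

(** Let R be the reproducing kernel, U the discretization operator, F a reproduced
    function, t_i = F(x_i) its samples, and A = sum_i |t_i| Phi_i. Choosing
    unimodular functions gamma_i with
      |R(x,y) - gamma_i(y) R(x,x_i)| <= osc(x,y)   whenever Phi_i(y) <> 0,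
    one puts H = sum_i conj(gamma_i) t_i Phi_i and writes
      F - U F = R(F - H) + (R H - U F).
    Since F(y) and F(x_i) are integrals of F against the rows of R at y and x_i,
    |F - H| is at most the adjoint oscillation applied to |F|; and U F being the
    integral over y of sum_i t_i Phi_i(y) R(x,x_i), |R H - U F| is at most the
    oscillation applied to A. Finally A is at most the adjoint maximal kernel
    applied to |F|. Solidity turns these pointwise bounds into norm bounds, and
    the quasi-triangle inequality is used once, which gives the constant of the
    estimate ([sampling_error], [sampling_error_kernel]).

    Three points need care. The phase function is not assumed measurable, so H
    could not be integrated if gamma_i were built from it; [measurable_phase]
    replaces it by measurable phases with the same bound and no loss. The maximal
    kernel need not act boundedly; then the right-hand side of the estimate is
    infinite, and boundedness of U rests instead on the majorant of A by the
    adjoint oscillation plus |R|, both applied to |F| ([samples_le_osc]). Finally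
    U F has to be reproduced again: it is a superposition of columns of R, and the
    majorants just found justify exchanging the sum with the integral against R
    ([reproducing_family], which also shows that R is idempotent).

    Countably many members of the covering are in play, so that sums over the
    index set are integrals over the natural numbers with the counting measure,
    and every exchange of sums and integrals is an instance of Fubini's theorem
    for complex functions ([cint_fubini]). *)

(** * Complex-valued functions and integrals *)

Section modulus.
Context {R : realType}.
Implicit Types z w : R[i].

Lemma cabs_ge0 z : 0 <= cabs z.
Proof. by case: z => a b; rewrite /cabs /= sqrtr_ge0. Qed.

Lemma cabsM z w : cabs (z * w) = cabs z * cabs w.
Proof. exact: Normc.normcM. Qed.

Lemma cabsD z w : cabs (z + w) <= cabs z + cabs w.
Proof. exact: le_normcD. Qed.

Lemma cabsN z : cabs (- z) = cabs z.
Proof. exact: normcN. Qed.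

Lemma cabs0 : cabs (0 : R[i]) = 0.
Proof. exact: Normc.normc0. Qed.

Lemma cabs1 : cabs (1 : R[i]) = 1.
Proof. exact: Normc.normc1. Qed.

Lemma cabs_eq0 z : cabs z = 0 -> z = 0.
Proof. exact: Normc.eq0_normc. Qed.

Lemma cabsR (r : R) : cabs r%:C%C = `|r|.
Proof. by rewrite /cabs /= expr0n addr0 sqrtr_sqr. Qed.

Lemma cabs_conj z : cabs (Num.conj z) = cabs z.
Proof. by case: z => a b; rewrite /cabs /= sqrrN. Qed.

Lemma Re_le_cabs z : `|complex.Re z| <= cabs z.
Proof.
case: z => a b; rewrite /cabs /= -sqrtr_sqr ler_wsqrtr// lerDl.
exact: sqr_ge0.
Qed.

Lemma Im_le_cabs z : `|complex.Im z| <= cabs z.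
Proof.
case: z => a b; rewrite /cabs /= -sqrtr_sqr ler_wsqrtr// lerDr.
exact: sqr_ge0.
Qed.

Lemma cabs_le_ReIm z : cabs z <= `|complex.Re z| + `|complex.Im z|.
Proof.
rewrite [in cabs z](complexE z) (le_trans (cabsD _ _))// cabsM !cabsR.
by rewrite /cabs /= expr0n expr1n add0r sqrtr1 mul1r.
Qed.

Lemma cabs_sqr z : cabs z ^+ 2 = complex.Re z ^+ 2 + complex.Im z ^+ 2.
Proof. by case: z => a b; rewrite /cabs /= sqr_sqrtr// addr_ge0// sqr_ge0. Qed.

Lemma ReD z w : complex.Re (z + w) = complex.Re z + complex.Re w.
Proof. by case: z; case: w. Qed.

Lemma ImD z w : complex.Im (z + w) = complex.Im z + complex.Im w.
Proof. by case: z; case: w. Qed.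

Lemma ReM z w :
  complex.Re (z * w) = complex.Re z * complex.Re w - complex.Im z * complex.Im w.
Proof. by case: z; case: w. Qed.

Lemma ImM z w :
  complex.Im (z * w) = complex.Re z * complex.Im w + complex.Im z * complex.Re w.
Proof. by case: z; case: w. Qed.

Lemma eqC z w : complex.Re z = complex.Re w -> complex.Im z = complex.Im w -> z = w.
Proof. by case: z => a b; case: w => c d /= -> ->. Qed.

(** Every modulus is a real part after a rotation, which reduces bounds on the
    modulus of an integral to bounds on real integrals. *)
Lemma cabs_rotation z : exists2 u : R[i], cabs u = 1 & complex.Re (u * z) = cabs z.
Proof.
have [->|z0] := eqVneq z 0.
  by exists 1; rewrite ?cabs1// mul1r cabs0.
have cz : cabs z != 0 by apply: contraNneq z0 => /cabs_eq0 ->.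
exists ((cabs z)^-1%:C%C * Num.conj z).
  by rewrite cabsM cabs_conj cabsR ger0_norm ?invr_ge0 ?cabs_ge0// mulVf.
have := cabs_sqr z; move: cz; set c := cabs z; clearbody c.
case: z z0 => a b _ c0 /= E; rewrite !(mul0r, mulr0, subr0, addr0).
apply: (mulfI c0); rewrite -expr2 E; field; exact: c0.
Qed.

End modulus.

Section cmeasurable_functions.
Context {R : realType} {d : measure_display} {T : measurableType d}.
Implicit Types f g : T -> R[i].

Lemma cmeasurableD f g : cmeasurable f -> cmeasurable g ->
  cmeasurable (fun x => f x + g x).
Proof.
move=> [f1 f2] [g1 g2]; split.
  by under eq_fun do rewrite ReD; exact: measurable_funD.
by under eq_fun do rewrite ImD; exact: measurable_funD.
Qed.

Lemma cmeasurableM f g : cmeasurable f -> cmeasurable g ->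
  cmeasurable (fun x => f x * g x).
Proof.
move=> [f1 f2] [g1 g2]; split.
  under eq_fun do rewrite ReM.
  by apply: measurable_funB; exact: measurable_funM.
under eq_fun do rewrite ImM.
by apply: measurable_funD; exact: measurable_funM.
Qed.

Lemma cmeasurable_cst (a : R[i]) : cmeasurable (fun _ : T => a).
Proof. by split; exact: measurable_cst. Qed.

Lemma cmeasurableZ (a : R[i]) f : cmeasurable f -> cmeasurable (fun x => a * f x).
Proof. by move=> mf; apply: cmeasurableM => //; exact: cmeasurable_cst. Qed.

Lemma cmeasurableB f g : cmeasurable f -> cmeasurable g ->
  cmeasurable (fun x => f x - g x).
Proof.
move=> mf mg; under eq_fun do rewrite -mulN1r.
by apply: cmeasurableD => //; exact: cmeasurableZ.
Qed.

Lemma cmeasurable_conj f : cmeasurable f -> cmeasurable (fun x => Num.conj (f x)).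
Proof.
move=> [f1 f2]; split.
  by rewrite [X in measurable_fun _ X](_ : _ = fun x => complex.Re (f x))//;
    apply/funext => x; case: (f x).
rewrite [X in measurable_fun _ X](_ : _ = fun x => - complex.Im (f x)).
  exact: measurable_funN.
by apply/funext => x; case: (f x).
Qed.

Lemma cmeasurableR (h : T -> R) : measurable_fun setT h ->
  cmeasurable (fun x => (h x)%:C%C).
Proof. by split => //=; exact: measurable_cst. Qed.

Lemma measurable_cabs f : cmeasurable f -> measurable_fun setT (fun x => cabs (f x)).
Proof.
move=> [f1 f2].
rewrite [X in measurable_fun _ X](_ : _ = fun x =>
    Num.sqrt (complex.Re (f x) ^+ 2 + complex.Im (f x) ^+ 2)).
  apply: (@measurableT_comp _ _ _ _ _ _ (@Num.sqrt R)).
    by apply: continuous_measurable_fun; exact: sqrt_continuous.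
  by apply: measurable_funD; apply: measurable_funX.
by apply/funext => x; rewrite -cabs_sqr sqrtr_sqr ger0_norm ?cabs_ge0.
Qed.

Lemma cmeasurable_cabs f : cmeasurable f -> cmeasurable (fun x => (cabs (f x))%:C%C).
Proof. by move=> mf; exact/cmeasurableR/measurable_cabs. Qed.

Lemma cmeasurable_comp {d'} {T' : measurableType d'} (h : T' -> T) f :
  measurable_fun setT h -> cmeasurable f -> cmeasurable (fun x => f (h x)).
Proof.
move=> mh [f1 f2].
by split; [exact: measurableT_comp f1 mh|exact: measurableT_comp f2 mh].
Qed.

Lemma emeasurable_cabs f : cmeasurable f ->
  measurable_fun setT (fun x => (cabs (f x))%:E).
Proof. by move=> mf; apply/measurable_EFinP; exact: measurable_cabs. Qed.

End cmeasurable_functions.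

Section complex_integral.
Context {R : realType} {d : measure_display} {T : measurableType d}.
Variable mu : {measure set T -> \bar R}.
Implicit Types f g : T -> R[i].
Local Open Scope ereal_scope.

(** Domination almost everywhere forces [h] to be nonnegative almost everywhere, so
    that its integral is the integral of its modulus. *)
Lemma cintegrable_le f (h : T -> \bar R) : cmeasurable f ->
  measurable_fun setT h -> \int[mu]_x h x < +oo ->
  {ae mu, forall x, (cabs (f x))%:E <= h x} -> cintegrable mu f.
Proof.
move=> mf mh hoo fh; split => //.
apply: (@le_lt_trans _ _ (\int[mu]_x `|h x|)).
  apply: ae_ge0_le_integral => //.
  - by move=> x _; rewrite lee_fin cabs_ge0.
  - exact: emeasurable_cabs.
  - exact: measurableT_comp.
  - by apply: filterS fh => x fx _; rewrite (le_trans fx)// lee_abs.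
rewrite (ae_eq_integral h) //; first exact: measurableT_comp.
apply: filterS fh => x fx _; rewrite gee0_abs// (le_trans _ fx)// lee_fin.
exact: cabs_ge0.
Qed.

Lemma integrable_le_cabs f (h : T -> R) : cintegrable mu f ->
  measurable_fun setT h -> (forall x, (`|h x| <= cabs (f x))%R) ->
  mu.-integrable setT (EFin \o h).
Proof.
move=> [mf foo] mh hf; apply/integrableP; split; first exact/measurable_EFinP.
apply: le_lt_trans foo; apply: ge0_le_integral => //.
- by apply/measurableT_comp => //; exact/measurable_EFinP.
- exact: emeasurable_cabs.
- by move=> x _; rewrite /= lee_fin hf.
Qed.

Lemma cintegrable_Re f : cintegrable mu f ->
  mu.-integrable setT (EFin \o (fun x => complex.Re (f x))).
Proof.
move=> intf; apply: (integrable_le_cabs intf); first by case: intf => -[].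
by move=> x; exact: Re_le_cabs.
Qed.

Lemma cintegrable_Im f : cintegrable mu f ->
  mu.-integrable setT (EFin \o (fun x => complex.Im (f x))).
Proof.
move=> intf; apply: (integrable_le_cabs intf); first by case: intf => -[].
by move=> x; exact: Im_le_cabs.
Qed.

Lemma cintegrableZ (a : R[i]) f : cintegrable mu f ->
  cintegrable mu (fun x => (a * f x)%R).
Proof.
move=> [mf foo]; split; first exact: cmeasurableZ.
under eq_integral do rewrite cabsM EFinM.
rewrite ge0_integralZl//.
- by rewrite lte_mul_pinfty// lee_fin cabs_ge0.
- exact: emeasurable_cabs.
- by move=> x _; rewrite lee_fin cabs_ge0.
- by rewrite lee_fin cabs_ge0.
Qed.

Lemma cintegrableD f g : cintegrable mu f -> cintegrable mu g ->
  cintegrable mu (fun x => (f x + g x)%R).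
Proof.
move=> [mf foo] [mg goo].
apply: (@cintegrable_le _ (fun x => (cabs (f x))%:E + (cabs (g x))%:E)).
- exact: cmeasurableD.
- by apply: emeasurable_funD; exact: emeasurable_cabs.
- rewrite ge0_integralD//; first exact: lte_add_pinfty.
  + by move=> x _; rewrite lee_fin cabs_ge0.
  + exact: emeasurable_cabs.
  + by move=> x _; rewrite lee_fin cabs_ge0.
  + exact: emeasurable_cabs.
- by apply: aeW => x; rewrite -EFinD lee_fin cabsD.
Qed.

Lemma cintegrableB f g : cintegrable mu f -> cintegrable mu g ->
  cintegrable mu (fun x => (f x - g x)%R).
Proof.
move=> intf intg; under eq_fun do rewrite -mulN1r.
by apply: cintegrableD => //; exact: cintegrableZ.
Qed.

Lemma cintD f g : cintegrable mu f -> cintegrable mu g ->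
  cint mu (fun x => (f x + g x)%R) = (cint mu f + cint mu g)%R.
Proof.
move=> intf intg; apply: eqC; rewrite ?ReD ?ImD /=.
- under eq_integral do rewrite ReD.
  by apply: RintegralD => //; exact: cintegrable_Re.
- under eq_integral do rewrite ImD.
  by apply: RintegralD => //; exact: cintegrable_Im.
Qed.

Lemma cintZ (a : R[i]) f : cintegrable mu f ->
  cint mu (fun x => (a * f x)%R) = (a * cint mu f)%R.
Proof.
move=> intf.
have iR := cintegrable_Re intf; have iI := cintegrable_Im intf.
have iZ (r : R) (h : T -> R) : mu.-integrable setT (EFin \o h) ->
    mu.-integrable setT (EFin \o (fun x => r * h x)%R).
  by move=> /(integrableZl measurableT r).
apply: eqC; rewrite ?ReM ?ImM /=.
- under eq_integral do rewrite ReM.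
  rewrite -[LHS]/(Rintegral mu setT (fun x => _)) RintegralB ?RintegralZl//; exact: iZ.
- under eq_integral do rewrite ImM.
  by rewrite -/(Rintegral _ _ _) RintegralD ?RintegralZl//; exact: iZ.
Qed.

Lemma cintB f g : cintegrable mu f -> cintegrable mu g ->
  cint mu (fun x => (f x - g x)%R) = (cint mu f - cint mu g)%R.
Proof.
move=> intf intg; rewrite -(mulN1r (cint mu g)) -cintZ// -cintD//; last first.
  exact: cintegrableZ.
by congr cint; apply/funext => x; rewrite mulN1r.
Qed.

Lemma cint_ae_eq f g : cmeasurable f -> cmeasurable g ->
  {ae mu, forall x, f x = g x} -> cint mu f = cint mu g.
Proof.
move=> [f1 f2] [g1 g2] fg; rewrite /cint; congr (fine _ +i* fine _)%C.
- apply: ae_eq_integral => //; [exact/measurable_EFinP|exact/measurable_EFinP|].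
  by apply: filterS fg => x ->.
- apply: ae_eq_integral => //; [exact/measurable_EFinP|exact/measurable_EFinP|].
  by apply: filterS fg => x ->.
Qed.

Lemma cintR (h : T -> R) :
  cint mu (fun x => (h x)%:C%C) = (fine (\int[mu]_x (h x)%:E))%:C%C.
Proof. by rewrite /cint /=; congr (_ +i* _)%C; rewrite integral0. Qed.

(** After rotating the integral onto the positive axis, its modulus is the integral
    of a real part. *)
Lemma le_cabs_cint f : cintegrable mu f ->
  (cabs (cint mu f))%:E <= \int[mu]_x (cabs (f x))%:E.
Proof.
move=> intf; have [u u1 <-] := cabs_rotation (cint mu f).
rewrite -cintZ//= -/(Rintegral _ _ _).
have iuf := cintegrableZ u intf; have iR := cintegrable_Re iuf.
apply: (@le_trans _ _ (`|\int[mu]_x complex.Re (u * f x)%R|%R)%:E).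
  by rewrite lee_fin ler_norm.
rewrite EFin_normr_Rintegral//.
apply: (le_trans (le_abse_integral mu measurableT _)).
  by case/integrableP: iR.
apply: ge0_le_integral => //.
- by apply: measurableT_comp => //; case/integrableP: iR.
- by apply: emeasurable_cabs; case: intf.
- by move=> x _; rewrite /= lee_fin (le_trans (Re_le_cabs _))// cabsM u1 mul1r.
Qed.

Lemma integral_cabs_fin f : cintegrable mu f ->
  \int[mu]_x (cabs (f x))%:E \is a fin_num.
Proof.
move=> [mf foo]; rewrite ge0_fin_numE//; apply: integral_ge0 => x _.
by rewrite lee_fin cabs_ge0.
Qed.

End complex_integral.

(** * Iterated integrals *)

Section sections.
Context {R : realType} {d1 d2 : measure_display}.
Context {T1 : measurableType d1} {T2 : measurableType d2}.
Local Open Scope ereal_scope.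

Lemma cmeasurable_pair1 (f : T1 * T2 -> R[i]) x : cmeasurable f ->
  cmeasurable (fun y => f (x, y)).
Proof. exact: cmeasurable_comp (pair1_measurable x). Qed.

Lemma measurable_prod_nat {d} {T : measurableType d} (f : T1 * nat -> T) :
  (forall n, measurable_fun setT (fun x => f (x, n))) -> measurable_fun setT f.
Proof.
move=> mf _ Y mY; rewrite setTI.
rewrite (_ : _ @^-1` _ =
    \bigcup_n ((fun x => f (x, n)) @^-1` Y `*` [set n])); last first.
  apply/seteqP; split => [[x n] /= Yx|[x n] [m _ [/= Yx ->//]]].
  by exists n.
apply: bigcupT_measurable => n; apply: measurableX => //.
by rewrite -[X in measurable X]setTI; exact: mf.
Qed.

Lemma cmeasurable_prod_nat (f : T1 * nat -> R[i]) :
  (forall n, cmeasurable (fun x => f (x, n))) -> cmeasurable f.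
Proof.
by move=> mf; split; apply: measurable_prod_nat => n; case: (mf n).
Qed.

Lemma cmeasurable_nat (f : nat -> R[i]) : cmeasurable f.
Proof. by split. Qed.

End sections.

Section complex_fubini.
Context {R : realType} {d1 d2 : measure_display}.
Context {T1 : measurableType d1} {T2 : measurableType d2}.
Variables (m1 : {sigma_finite_measure set T1 -> \bar R}).
Variables (m2 : {sigma_finite_measure set T2 -> \bar R}).
Local Open Scope ereal_scope.

(** Positive and negative parts have measurable partial integrals by Tonelli's
    theorem, and so has their difference in the extended reals. *)
Lemma measurable_integral2 (h : T1 * T2 -> \bar R) :
  measurable_fun setT h -> measurable_fun setT (fun x => \int[m2]_y h (x, y)).
Proof.
move=> mh.
rewrite [X in measurable_fun _ X](_ : _ =
    (fubini_F m2 h^\+ \- fubini_F m2 h^\-)); last first.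
  apply/funext => x; rewrite [LHS]integralE.
  under eq_integral do rewrite funepos_comp/=.
  by under [X in _ - X = _]eq_integral do rewrite funeneg_comp/=.
apply: emeasurable_funB; apply: measurable_fun_fubini_tonelli_F => //.
  exact: measurable_funepos.
exact: measurable_funeneg.
Qed.

Lemma cmeasurable_cint2 (f : T1 * T2 -> R[i]) : cmeasurable f ->
  cmeasurable (fun x => cint m2 (fun y => f (x, y))).
Proof.
move=> [f1 f2]; split => /=.
  apply: (@measurableT_comp _ _ _ _ _ _ fine); first exact: fine_measurable.
  by apply: measurable_integral2 (fun p => (complex.Re (f p))%:E) _;
    exact/measurable_EFinP.
apply: (@measurableT_comp _ _ _ _ _ _ fine); first exact: fine_measurable.
by apply: measurable_integral2 (fun p => (complex.Im (f p))%:E) _;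
  exact/measurable_EFinP.
Qed.

Lemma tonelli_cabs (f : T1 * T2 -> R[i]) : cmeasurable f ->
  \int[m1]_x \int[m2]_y (cabs (f (x, y)))%:E =
  \int[m2]_y \int[m1]_x (cabs (f (x, y)))%:E.
Proof.
move=> mf; apply: (@fubini_tonelli _ _ _ _ _ m1 m2 (fun p => (cabs (f p))%:E)).
  exact: emeasurable_cabs.
by move=> p; rewrite lee_fin cabs_ge0.
Qed.

Lemma Rintegral_fubini (h : T1 * T2 -> R) :
  (m1 \x m2).-integrable setT (EFin \o h) ->
  (\int[m1]_x \int[m2]_y h (x, y) = \int[m2]_y \int[m1]_x h (x, y))%R.
Proof.
move=> ih; have mh : measurable_fun setT (EFin \o h) by case/integrableP: ih.
congr fine; transitivity (\int[m1]_x \int[m2]_y (h (x, y))%:E).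
  apply: ae_eq_integral => //.
  - apply/measurable_EFinP; apply: (@measurableT_comp _ _ _ _ _ _ fine).
      exact: fine_measurable.
    exact: measurable_integral2 mh.
  - exact: measurable_integral2 mh.
  - apply: filterS (ae_integrable1 ih) => x ix _.
    by rewrite fineK//; exact: integrable_fin_num ix.
rewrite (Fubini ih); apply: ae_eq_integral => //.
- exact: measurable_fubini_G ih.
- apply/measurable_EFinP; apply: (@measurableT_comp _ _ _ _ _ _ fine).
    exact: fine_measurable.
  exact: measurable_fubini_G ih.
- apply: filterS (ae_integrable2 ih) => x ix _.
  by rewrite /fubini_G fineK//; exact: integrable_fin_num ix.
Qed.

Variable f : T1 * T2 -> R[i].
Hypothesis mf : cmeasurable f.
Hypothesis foo : \int[m1]_x \int[m2]_y (cabs (f (x, y)))%:E < +oo.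

Let intcabs (h : T1 * T2 -> R) : measurable_fun setT h ->
  (forall p, `|h p| <= cabs (f p))%R -> (m1 \x m2).-integrable setT (EFin \o h).
Proof.
move=> mh hf; apply/integrable12ltyP; first exact/measurable_EFinP.
apply: le_lt_trans foo; apply: ge0_le_integral => //.
- by move=> x _; exact: integral_ge0.
- apply: measurable_integral2 (fun p => `|(h p)%:E|) _.
  by apply: measurableT_comp => //; exact/measurable_EFinP.
- apply: measurable_integral2 (fun p => (cabs (f p))%:E) _.
  exact: emeasurable_cabs.
move=> x _; apply: ge0_le_integral => //.
- apply: measurableT_comp => //; apply/measurable_EFinP.
  exact: measurable_fun_pair2 mh.
- by apply: emeasurable_cabs; exact: cmeasurable_pair1.
- by move=> y _; rewrite lee_fin.
Qed.

Lemma ae_cintegrable_pair1 :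
  {ae m1, forall x, cintegrable m2 (fun y => f (x, y))}.
Proof.
have ic : (m1 \x m2).-integrable setT (EFin \o (fun p => cabs (f p))).
  apply: intcabs; first exact: measurable_cabs.
  by move=> p; rewrite ger0_norm// cabs_ge0.
apply: filterS (ae_integrable1 ic) => x /integrableP[_ ix]; split.
  exact: cmeasurable_pair1.
apply: le_lt_trans ix; apply: ge0_le_integral => //.
- by move=> y _; rewrite lee_fin cabs_ge0.
- by apply: emeasurable_cabs; exact: cmeasurable_pair1.
- by apply: measurableT_comp => //; apply: emeasurable_cabs; exact: cmeasurable_pair1.
- by move=> y _; rewrite /= lee_fin ler_norm.
Qed.

Lemma cintegrable_cint2 : cintegrable m1 (fun x => cint m2 (fun y => f (x, y))).
Proof.
apply: (@cintegrable_le _ _ _ _ _ (fun x => \int[m2]_y (cabs (f (x, y)))%:E)) => //.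
- exact: cmeasurable_cint2.
- by apply: measurable_integral2 (fun p => (cabs (f p))%:E) _; exact: emeasurable_cabs.
- by apply: filterS ae_cintegrable_pair1 => x ix; exact: le_cabs_cint.
Qed.

(** Real and imaginary parts are dominated by the modulus, and the intermediate
    [fine] of a partial integral only matters on a null set. *)
Lemma cint_fubini :
  cint m1 (fun x => cint m2 (fun y => f (x, y))) =
  cint m2 (fun y => cint m1 (fun x => f (x, y))).
Proof.
apply: eqC.
- apply: (Rintegral_fubini (h := fun p => complex.Re (f p))).
  by apply: intcabs; [case: mf|move=> p; exact: Re_le_cabs].
- apply: (Rintegral_fubini (h := fun p => complex.Im (f p))).
  by apply: intcabs; [case: mf|move=> p; exact: Im_le_cabs].
Qed.

End complex_fubini.

Section null_sections.
Context {R : realType} {d : measure_display} {T : measurableType d}.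
Variable mu : {sigma_finite_measure set T -> \bar R}.
Local Open Scope ereal_scope.

Lemma ae_product (P : T * T -> Prop) : {ae (mu \x mu), forall p, P p} ->
  {ae mu, forall x, {ae mu, forall y, P (x, y)}}.
Proof.
move=> [N [mN N0 PN]].
have mx : measurable_fun setT (mu \o xsection N) by exact: measurable_fun_xsection.
have /ae_eq_integral_abs : \int[mu]_x `|(mu \o xsection N) x| = 0.
  by rewrite -[RHS]N0; apply: eq_integral => x _; rewrite gee0_abs.
move=> /(_ measurableT mx); apply: filterS => x /(_ I) /= Nx0.
exists (xsection N x); split => //; first exact: measurable_xsection.
by move=> y /= nP; rewrite /xsection/= inE; exact: PN.
Qed.

(** The exceptional set is measurable, so its product measure can be computed by
    slicing in either order. *)
Lemma ae_ae_swap (E : set (T * T)) : measurable E ->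
  {ae mu, forall y, {ae mu, forall x, E (x, y)}} ->
  {ae mu, forall x, {ae mu, forall y, E (x, y)}}.
Proof.
move=> mE aeE; apply: ae_product.
have mEc : measurable (~` E) by exact: measurableC.
exists (~` E); split => //.
rewrite (@product_measure_unique _ _ _ _ _ mu mu (mu \x^ mu)); last 2 first.
- by move=> A B mA mB; exact: product_measure2E.
- exact: mEc.
apply: etrans (integral0 mu setT); apply: ae_eq_integral => //.
  exact: measurable_fun_ysection.
apply: filterS aeE => y aey _ /=; apply/negligibleP.
  exact: measurable_ysection.
apply: negligibleS aey => x /=; rewrite /ysection/= inE.
by [].
Qed.

End null_sections.

(** * Absolutely summable families as integrals *)

HB.instance Definition _ (R : realType) :=
  @Measure_isSigmaFinite.Build _ _ _ (@counting nat R) (sigma_finite_counting R).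

Section countable_sums.
Context {R : realType} {I : choiceType}.
Variables (code : I -> nat) (decode : nat -> option I).
Hypothesis codeK : forall i, decode (code i) = Some i.
Hypothesis decodeK : forall n i, decode n = Some i -> code i = n.
Local Open Scope ereal_scope.

(** The naturals that code no index contribute the default value zero. *)
Lemma esum_counting (f : I -> \bar R) : (forall i, 0 <= f i) ->
  \esum_(i in [set: I]) f i = \int[counting]_n oapp f 0 (decode n).
Proof.
move=> f0; pose g n := oapp f 0 (decode n).
have g0 n : 0 <= g n by rewrite /g; case: decode.
rewrite ge0_integral_count// nneseries_esumT//.
transitivity (\esum_(n in range code) g n).
  rewrite (reindex_esum setT _ code) //; last first.
    split; [by move=> i _; exists i|move=> i j _ _ /(congr1 decode)|by []].
    by rewrite !codeK => -[].
  by apply: eq_esum => i _; rewrite /g codeK.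
rewrite esum_mkcond; apply: eq_esum => n _; case: ifPn => //.
rewrite notin_setE => nr; rewrite /g; case E: (decode n) => [i|//].
by case: nr; exists i => //; exact: decodeK.
Qed.

Lemma csum_counting (f : I -> R[i]) : cabs_summable f ->
  cintegrable counting (fun n => oapp f 0%R (decode n)) /\
  csum f = cint counting (fun n => oapp f 0%R (decode n)).
Proof.
move=> fs; pose g n := oapp f 0%R (decode n).
have ig : cintegrable counting g.
  split; first exact: cmeasurable_nat.
  apply: le_lt_trans fs; rewrite esum_counting; last first.
    by move=> i; rewrite lee_fin cabs_ge0.
  rewrite le_eqVlt; apply/orP; left; apply/eqP; apply: eq_integral => n _.
  by rewrite /g; case: decode => [i|]; rewrite /oapp ?cabs0.
split=> //.
have aux (p : R[i] -> R) : p 0%R = 0%R ->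
    (counting : set nat -> \bar R).-integrable setT (EFin \o (fun n => p (g n))) ->
    rsum (fun i => p (f i)) = fine (\int[counting]_n (p (g n))%:E).
  move=> p0 ip; rewrite /rsum integralE fineB; last 2 first.
  - exact: integrable_pos_fin_num ip.
  - exact: integrable_neg_fin_num ip.
  congr (fine _ - fine _)%R.
  - rewrite esum_counting; last by move=> i; rewrite lee_fin le_max lexx orbT.
    apply: eq_integral => n _; rewrite funeposE /g -EFin_max.
    by case: decode => [i|]; rewrite /oapp ?p0 ?maxxx.
  - rewrite esum_counting; last by move=> i; rewrite lee_fin le_max lexx orbT.
    apply: eq_integral => n _; rewrite funenegE /g -EFinN -EFin_max.
    by case: decode => [i|]; rewrite /oapp ?p0 ?oppr0 ?maxxx.
apply: eqC => /=; apply: aux => //; [exact: cintegrable_Re|exact: cintegrable_Im].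
Qed.

(** This holds even where the family is not summable, since the sum is assembled
    from four sums of nonnegative terms. *)
Lemma cmeasurable_csum {d} {T : measurableType d} (f : T -> I -> R[i]) :
  (forall i, cmeasurable (fun x => f x i)) -> cmeasurable (fun x => csum (f x)).
Proof.
move=> mf.
have aux (u : T -> I -> R) : (forall i, measurable_fun setT (u^~ i)) ->
    measurable_fun setT (fun x => fine (\esum_(i in [set: I]) (Num.max (u x i) 0)%:E)).
  move=> mu.
  have mh : measurable_fun setT (fun p : T * nat =>
      oapp (fun i => (Num.max (u p.1 i) 0)%:E) 0 (decode p.2)).
    apply: measurable_prod_nat => n /=; case: decode => [i|] /=.
      by apply/measurable_EFinP; exact: measurable_maxr.
    exact: measurable_cst.
  rewrite [X in measurable_fun _ X](_ : _ = fun x => fine (\int[counting]_n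
      oapp (fun i => (Num.max (u x i) 0)%:E) 0 (decode n))); last first.
    apply/funext => x; rewrite esum_counting// => i.
    by rewrite lee_fin le_max lexx orbT.
  exact: (measurableT_comp (fine_measurable measurableT)
    (measurable_integral2 (@counting nat R) mh)).
have auxN (u : T -> I -> R) : (forall i, measurable_fun setT (u^~ i)) ->
    measurable_fun setT (fun x => rsum (u x)).
  move=> mu; apply: measurable_funB; first exact: aux.
  by apply: (aux (fun x i => - u x i)%R) => i; exact: measurable_funN.
by split; apply: auxN => i; case: (mf i).
Qed.

End countable_sums.

(** * Measurable choice of phases *)

Section unit_circle.
Context {R : realType}.

Definition circle (t : R) : R[i] := (cos t +i* sin t)%C.

Lemma cabs_circle t : cabs (circle t) = 1.
Proof. by rewrite /circle /cabs /= cos2Dsin2 sqrtr1. Qed.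

Lemma circle_surj (z : R[i]) : cabs z = 1 ->
  exists2 t : R, - pi <= t <= pi & circle t = z.
Proof.
move=> z1; have := cabs_sqr z; rewrite z1 expr1n.
case: z {z1} => a b /= ab.
have a1 : -1 <= a <= 1.
  by rewrite -ler_norml -sqrtr_sqr -sqrtr1 ler_wsqrtr// ab lerDl sqr_ge0.
have sb : sin (acos a) = `|b|.
  by rewrite sin_acos// ab [a ^+ 2 + _]addrC addrK sqrtr_sqr.
have cK : cos (acos a) = a by apply: acosK; rewrite in_itv.
have p0 := acos_ge0 a1; have pp := acos_lepi a1.
have [b0|b0] := leP 0 b.
  exists (acos a); last by rewrite /circle cK sb ger0_norm.
  by rewrite pp andbT (le_trans _ p0)// oppr_le0 pi_ge0.
exists (- acos a); last by rewrite /circle cosN sinN cK sb ltr0_norm// opprK.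
by rewrite lerN2 pp /= (le_trans _ (pi_ge0 R))// oppr_le0.
Qed.

Let lipschitz (f df : R -> R) : (forall x : R, is_derive x 1 f (df x)) ->
  (forall x, `|df x| <= 1) -> forall s t, `|f s - f t| <= `|s - t|.
Proof.
move=> fdf df1; have H s t : s <= t -> `|f t - f s| <= `|t - s|.
  move=> st; have [|c _ ->] := @MVT_segment R f df s t st (fun x _ => fdf x).
    apply: derivable_within_continuous => x _.
    by have := fdf x => -[].
  by rewrite normrM ler_piMl.
move=> s t; have [/H|/ltW /H //] := leP s t.
by rewrite distrC [`|t - s|]distrC.
Qed.

(** The constant is not sharp; it comes from adding the two coordinates. *)
Lemma circle_lipschitz s t : cabs (circle s - circle t) <= 2 * `|s - t|.
Proof.
rewrite (le_trans (cabs_le_ReIm _))// mulr2n mulrDl mul1r /=.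
apply: lerD.
  apply: (lipschitz (df := fun x => - sin x)) => x.
  by rewrite normrN ler_norml sin_geN1 sin_le1.
apply: (lipschitz (df := cos)) => x.
by rewrite ler_norml cos_geN1 cos_le1.
Qed.

Lemma circle_measurable d (T : measurableType d) (t : T -> R) :
  measurable_fun setT t -> cmeasurable (fun y => circle (t y)).
Proof.
move=> mt; split => /=.
  apply: (@measurableT_comp _ _ _ _ _ _ (@cos R)) => //.
  by apply: continuous_measurable_fun; exact: continuous_cos.
apply: (@measurableT_comp _ _ _ _ _ _ (@sin R)) => //.
by apply: continuous_measurable_fun; exact: continuous_sin.
Qed.

End unit_circle.

(** A bounded sequence returns close to its upper limit infinitely often, hence an
    estimate along the sequence with vanishing errors passes to the upper limit. *)
Lemma limn_sup_recurrent {R : realType} (u : nat -> R) :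
  has_ubound (range u) -> has_lbound (range u) ->
  forall (N : nat) (e : R), 0 < e ->
  exists2 n, (N <= n)%N & `|u n - limn_sup u| < e.
Proof.
move=> ubu lbu N e e0.
have L : limn_sup u = inf (range (sups u)).
  by apply/cvg_lim => //; exact: cvg_sups_inf.
have hsd k : has_sup (sdrop u k).
  split; first by exists (u k); exists k => /=.
  by case: ubu => M hM; exists M => _ [j _ <-]; apply: hM; exists j.
have le_sups k j : (k <= j)%N -> u j <= sups u k.
  by move=> kj; apply: ub_le_sup; [case: (hsd k)|exists j].
have hinf : has_inf (range (sups u)).
  split; first by exists (sups u 0); exists 0%N.
  case: lbu => m hm; exists m => _ [k _ <-].
  by apply: (le_trans _ (le_sups k k (leqnn _))); apply: hm; exists k.
have [_ [k _ <-]] := inf_adherent e0 hinf; rewrite -L => kL.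
pose M := maxn N k.
have [_ [n /= Mn <-] nM] := sup_adherent e0 (hsd M).
exists n; first by rewrite (leq_trans _ Mn)// leq_maxl.
have LM : limn_sup u <= sups u M.
  by rewrite L; apply: ge_inf; [case: hinf|exists M].
have nk : u n <= sups u k by apply: le_sups; rewrite (leq_trans _ Mn)// leq_maxr.
rewrite -[sup _]/(sups u M) in nM.
rewrite ltr_norml; apply/andP; split; lra.
Qed.

Section phase_selection.
Context {R : realType} {d : measure_display} {T : measurableType d}.
Variable mu : {sigma_finite_measure set T -> \bar R}.
Variables (f : T * T -> R[i]) (g : T -> R[i]) (o : T * T -> R).
Hypotheses (mf : cmeasurable f) (mg : cmeasurable g).
Hypothesis mo : measurable_fun setT o.

(** The points where the phase [circle t] fails with tolerance [e]; whether it fits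
    at [y] is read off the measure of a section, which is measurable in [y]. *)
Let exceed e t : set (T * T) :=
  [set p | o p + e * cabs (g p.1) < cabs (f p - circle t * g p.1)].

Let measurable_exceed e t : measurable (exceed e t).
Proof.
have mgf : cmeasurable (fun p : T * T => g p.1).
  exact: cmeasurable_comp measurable_fst mg.
have mlt : measurable_fun setT (fun p : T * T =>
    o p + e * cabs (g p.1) < cabs (f p - circle t * g p.1)).
  apply: measurable_fun_ltr.
    apply: measurable_funD => //; apply: measurable_funM => //.
    exact: measurable_cabs.
  by apply: measurable_cabs; apply: cmeasurableB => //; exact: cmeasurableZ.
rewrite -[X in measurable X]setTI.
exact: (mlt measurableT [set true]).
Qed.

Let fits e t y := mu (ysection (exceed e t) y) == 0%E.

Let measurable_fits e t : measurable_fun setT (fits e t).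
Proof.
apply: measurable_fun_eqe; last exact: measurable_cst.
exact: measurable_fun_ysection.
Qed.

Let fitsP e t y : fits e t y <->
  {ae mu, forall x, cabs (f (x, y) - circle t * g x) <= o (x, y) + e * cabs (g x)}.
Proof.
rewrite /fits; split => [/eqP/negligibleP h|h].
  apply: negligibleS (h _); last exact: measurable_ysection.
  by move=> x /= /negP; rewrite -ltNge /ysection /= inE.
apply/eqP/negligibleP; first exact: measurable_ysection.
by apply: negligibleS h => x; rewrite /ysection /= inE /exceed /= ltNge => /negP.
Qed.

Let grid (n j : nat) : R := - pi + j%:R / n.+1%:R.

(** Twice the mesh, by the Lipschitz constant of [circle]. *)
Let tol (n : nat) : R := 2 / n.+1%:R.

Fixpoint first_fit n (s : seq nat) (y : T) : R :=
  if s is j :: s' then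
    if fits (tol n) (grid n j) y then grid n j else first_fit n s' y
  else 0.

Let measurable_first_fit n s : measurable_fun setT (first_fit n s).
Proof.
elim: s => [|j s IH] /=; first exact: measurable_cst.
exact: measurable_fun_ifT.
Qed.

(** The grid of mesh [1 / n.+1] starts at [- pi] and has enough points to pass [pi]. *)
Let bound := Num.truncn (2 * @pi R).

Let candidates n := iota 0 (bound.+1 * n.+1).

Let t_ n := first_fit n (candidates n).

Let t_bounded n y : - pi <= t_ n y <= - pi + bound.+1%:R.
Proof.
have Hb : pi <= - pi + bound.+1%:R :> R.
  have : 2 * pi < bound.+1%:R :> R by exact: truncnS_gt.
  by move=> ?; lra.
have pi0 := pi_ge0 R.
rewrite /t_; have : all (fun j => j < bound.+1 * n.+1)%N (candidates n).
  by apply/allP => j; rewrite mem_iota.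
elim: (candidates n) => [_|j s IH] /=; first by apply/andP; split; lra.
move=> /andP[jb /IH{}IH]; case: ifP => // _.
rewrite /grid lerDl divr_ge0//= lerD2l ler_pdivrMr// -natrM ler_nat.
exact: ltnW.
Qed.

Let t_fits n y (z : R[i]) : cabs z = 1 ->
  {ae mu, forall x, cabs (f (x, y) - z * g x) <= o (x, y)} ->
  fits (tol n) (t_ n y) y.
Proof.
move=> /circle_surj[th /andP[th1 th2] <-] H.
pose j := Num.truncn ((th + pi) * n.+1%:R).
have thp : 0 <= (th + pi) * n.+1%:R by rewrite mulr_ge0// -lerBlDr sub0r.
have /andP[j1 j2] := truncn_itv thp; rewrite -/j in j1 j2.
have n0 : 0 < n.+1%:R :> R by rewrite ltr0n.
have jfit : fits (tol n) (grid n j) y.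
  apply/fitsP; apply: filterS H => x Hx.
  have -> : f (x, y) - circle (grid n j) * g x =
      (f (x, y) - circle th * g x) + (circle th - circle (grid n j)) * g x.
    by ring.
  rewrite (le_trans (cabsD _ _))// lerD// cabsM ler_wpM2r ?cabs_ge0//.
  rewrite (le_trans (circle_lipschitz _ _))// /tol ler_wpM2l//.
  rewrite /grid ler_norml; apply/andP; split.
    rewrite -(ler_pM2r n0) mulNr mulVf ?gt_eqF// opprD opprK addrA mulrBl divfK ?gt_eqF//.
    lra.
  rewrite -(ler_pM2r n0) mulVf ?gt_eqF// opprD opprK addrA mulrBl divfK ?gt_eqF//.
  by rewrite -natr1 in j2; lra.
have jc : j \in candidates n.
  rewrite mem_iota /= add0n -(ltr_nat R) (le_lt_trans j1)// natrM ltr_pM2r//.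
  by rewrite (@le_lt_trans _ _ (2 * pi))// ?truncnS_gt//; lra.
rewrite /t_; elim: (candidates n) jc => //= k s IH.
rewrite inE; case: ifP => [//|nk] /orP[/eqP jk|]; last exact: IH.
by rewrite jk nk in jfit.
Qed.

(** The admissible phases at a point form a compact set, but depend on the
    point in no measurable way a priori. On a finite grid the first phase that
    fits up to a tolerance is measurable; letting the grids become finer, the
    upper limit of these phases fits exactly. *)
Lemma measurable_phase (D : set T) :
  {ae mu, forall y, D y -> exists2 z : R[i], cabs z = 1 &
     {ae mu, forall x, cabs (f (x, y) - z * g x) <= o (x, y)}} ->
  exists gam : T -> R[i], [/\ cmeasurable gam, forall y, cabs (gam y) = 1 &
    {ae mu, forall y, D y ->
      {ae mu, forall x, cabs (f (x, y) - gam y * g x) <= o (x, y)}}].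
Proof.
move=> H; pose t y := limn_sup (fun n => t_ n y).
have ub y : has_ubound (range (fun n => t_ n y)).
  by exists (- pi + bound.+1%:R) => _ [n _ <-]; case/andP: (t_bounded n y).
have lb y : has_lbound (range (fun n => t_ n y)).
  by exists (- pi) => _ [n _ <-]; case/andP: (t_bounded n y).
exists (fun y => circle (t y)); split.
- apply: circle_measurable; apply: measurable_fun_limn_sup => // n.
  exact: measurable_first_fit.
- by move=> y; exact: cabs_circle.
apply: filterS H => y Hy /Hy[z z1 Hz].
have : {ae mu, forall x, forall n,
    cabs (f (x, y) - circle (t_ n y) * g x) <= o (x, y) + tol n * cabs (g x)}.
  by apply: ae_foralln => n; apply/fitsP; exact: t_fits Hz.
apply: filterS => x Hx; apply/ler_addgt0Pr => e e0.
have c0 : 0 < 4 * (cabs (g x) + 1) :> R.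
  by rewrite mulr_gt0// ltr_wpDl// cabs_ge0.
(* The error is at most [tol n + 2 * e' <= 4 * e'] times [cabs (g x)]. *)
pose e' := e / (4 * (cabs (g x) + 1)).
have e'0 : 0 < e' by rewrite divr_gt0.
have [n Nn tn] := limn_sup_recurrent (ub y) (lb y) (Num.truncn e'^-1) e'0.
have n0 : 0 < n.+1%:R :> R by rewrite ltr0n.
have tole : tol n <= 2 * e'.
  rewrite /tol ler_wpM2l// invf_ple ?posrE// ltW// (lt_le_trans (truncnS_gt _))//.
  by rewrite ler_nat ltnS.
have -> : f (x, y) - circle (t y) * g x =
    (f (x, y) - circle (t_ n y) * g x) + (circle (t_ n y) - circle (t y)) * g x.
  by ring.
rewrite (le_trans (cabsD _ _))// (le_trans (lerD (Hx n) (lexx _)))// -addrA lerD2l.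
rewrite cabsM -mulrDl.
have g0 := cabs_ge0 (g x).
have : cabs (circle (t_ n y) - circle (t y)) <= 2 * e'.
  by rewrite (le_trans (circle_lipschitz _ _))// ler_wpM2l// ltW.
move=> ct; apply: (@le_trans _ _ ((4 * e') * cabs (g x))).
  by rewrite ler_wpM2r//; lra.
apply: (@le_trans _ _ ((4 * e') * (cabs (g x) + 1))).
  by rewrite ler_wpM2l ?lerDl//; lra.
have -> : 4 * e' * (cabs (g x) + 1) = e' * (4 * (cabs (g x) + 1)) by ring.
by rewrite /e' divfK// gt_eqF.
Qed.

End phase_selection.

(** * The reproducing kernel of a Parseval frame *)

Section reproducing_kernel.
Context {R : realType} {X : ptopologicalType} {H : completeNormedModType R[i]}.
Variables (mu : {measure set (borel X) -> \bar R}) (dot : {dot H for Num.conj}).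
Variable phi : borel X -> H.
Hypotheses (hilbH : hilbert_separable dot) (frame_phi : parseval_frame mu dot phi).
Implicit Types f g : H.

Lemma dotC f g : dot f g = Num.conj (dot g f).
Proof. by rewrite [LHS]hermC expr0 mul1r. Qed.

Lemma RkerC x y : Rker dot phi (x, y) = Num.conj (Rker dot phi (y, x)).
Proof. exact: dotC. Qed.

Lemma cabs_RkerC x y : cabs (Rker dot phi (x, y)) = cabs (Rker dot phi (y, x)).
Proof. by rewrite RkerC cabs_conj. Qed.

Lemma Re_dot_self f : complex.Re (dot f f) = hnorm f ^+ 2.
Proof.
case: hilbH => /(_ f) <- _; rewrite /hnorm.
have : `|f| \is Num.real by exact: normr_real.
by move=> /RRe_real <-; rewrite -rmorphXn.
Qed.

Let sq f x := cabs (voice dot phi f x) ^+ 2.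

Let voiceM f : cmeasurable (voice dot phi f).
Proof. by case: frame_phi. Qed.

Let sqM f : measurable_fun setT (sq f).
Proof. by apply: measurable_funX; exact: measurable_cabs. Qed.

Let sqE f : (\int[mu]_x (sq f x)%:E = (hnorm f ^+ 2)%:E)%E.
Proof. by case: frame_phi => _ ->. Qed.

Let sqI f : mu.-integrable setT (EFin \o sq f).
Proof.
apply/integrableP; split; first exact/measurable_EFinP.
under eq_integral do rewrite /= ger0_norm ?sqr_ge0//.
by rewrite sqE ltry.
Qed.

Let sqR f : \int[mu]_x sq f x = hnorm f ^+ 2.
Proof. by rewrite /Rintegral sqE. Qed.

Lemma cintegrable_voiceM f g :
  cintegrable mu (fun z => voice dot phi f z * Num.conj (voice dot phi g z)).
Proof.
apply: (@cintegrable_le _ _ _ _ _ (fun x => (sq f x)%:E + (sq g x)%:E)%E).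
- by apply: cmeasurableM => //; exact: cmeasurable_conj.
- by apply: emeasurable_funD; exact/measurable_EFinP.
- rewrite ge0_integralD//; last 4 first.
  + by move=> x _; rewrite lee_fin sqr_ge0.
  + exact/measurable_EFinP.
  + by move=> x _; rewrite lee_fin sqr_ge0.
  + exact/measurable_EFinP.
  by rewrite !sqE -EFinD ltry.
apply: aeW => x; rewrite -EFinD lee_fin cabsM cabs_conj /sq.
have := cabs_ge0 (voice dot phi f x); have := cabs_ge0 (voice dot phi g x).
nra.
Qed.

(** Imaginary parts follow by replacing [g] with ['i *: g]. *)
Let Re_polarization f g :
  complex.Re (cint mu (fun z => voice dot phi f z * Num.conj (voice dot phi g z)))
  = complex.Re (dot f g).
Proof.
rewrite /= -[LHS]/(Rintegral mu setT (fun z =>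
  complex.Re (voice dot phi f z * Num.conj (voice dot phi g z)))).
have -> : complex.Re (dot f g) =
    2^-1 * (hnorm (f + g) ^+ 2 - hnorm f ^+ 2 - hnorm g ^+ 2).
  rewrite -!Re_dot_self linearDl /= !linearDr /= !ReD [dot g f]dotC.
  have -> : complex.Re (Num.conj (dot f g)) = complex.Re (dot f g).
    by case: (dot f g).
  by field.
rewrite -!sqR -RintegralB// -RintegralB//; last first.
  exact: (integrableB measurableT (sqI _) (sqI _)).
rewrite -RintegralZl//; last first.
  exact: (integrableB measurableT (integrableB measurableT (sqI _) (sqI _)) (sqI g)).
apply: eq_Rintegral => x _; rewrite /sq /voice linearDl /=.
case: (dot f (phi x)) => a b; case: (dot g (phi x)) => c e.
by rewrite !cabs_sqr /=; field.
Qed.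

(** The frame being tight with constant one, polarization turns its energy
    identity into an identity of inner products. *)
Lemma parseval_dot f g :
  cint mu (fun z => voice dot phi f z * Num.conj (voice dot phi g z)) = dot f g.
Proof.
set J := cint _ _.
apply: eqC; first exact: Re_polarization.
have Imi (w : R[i]) : complex.Im w = complex.Re (Num.conj 'i%C * w).
  by case: w => a b /=; ring.
have dotZ h : dot h ('i%C *: g) = Num.conj 'i%C * dot h g.
  by rewrite linearZr_LR.
rewrite !Imi -dotZ -Re_polarization /J -cintZ; last exact: cintegrable_voiceM.
congr (complex.Re (cint mu _)); apply/funext => z; rewrite /voice.
have -> : dot ('i%C *: g) (phi z) = 'i%C * dot g (phi z) by rewrite linearZl_LR.
by rewrite rmorphM /= mulrCA.
Qed.

Lemma cintegrable_RkerM x y :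
  cintegrable mu (fun z => Rker dot phi (x, z) * Rker dot phi (z, y)).
Proof.
have := cintegrable_voiceM (phi y) (phi x).
by congr cintegrable; apply/funext => z; rewrite mulrC (RkerC x z).
Qed.

Lemma Rker_reproducing x y :
  cint mu (fun z => Rker dot phi (x, z) * Rker dot phi (z, y)) =
  Rker dot phi (x, y).
Proof.
rewrite -[RHS](parseval_dot (phi y) (phi x)); congr cint.
by apply/funext => z; rewrite mulrC (RkerC x z).
Qed.

Lemma cmeasurable_Rker2 y : cmeasurable (fun x => Rker dot phi (x, y)).
Proof. exact: (voiceM (phi y)). Qed.

End reproducing_kernel.

(** * Radon measures and admissible coverings *)

Section topology.
Context {R : realType} {X : ptopologicalType}.
Variable mu : {measure set (borel X) -> \bar R}.
Hypotheses (hausX : hausdorff_space X) (radonmu : radon mu).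

Lemma open_borel (A : set X) : open A -> measurable (A : set (borel X)).
Proof. by move=> oA; exact: sub_sigma_algebra. Qed.

Lemma closed_borel (A : set X) : closed A -> measurable (A : set (borel X)).
Proof.
move=> cA; rewrite -(setCK A); apply: measurableC; apply: open_borel.
exact: closed_openC.
Qed.

Lemma compact_borel (K : set X) : compact K -> measurable (K : set (borel X)).
Proof. by move=> cK; apply: closed_borel; exact: compact_closed. Qed.

Lemma radon_sigma_finite : sigma_compact X -> sigma_finite [set: borel X] mu.
Proof.
move=> [K [cK KX]]; exists K; first by rewrite KX.
move=> n; split; first exact: compact_borel.
by case: radonmu => + _ _; apply.
Qed.

Lemma radon_precompact (A : set (borel X)) : measurable A ->
  precompact (A : set X) -> (mu A < +oo)%E.
Proof.
rewrite precompactE => mA cA; case: radonmu => /(_ _ cA) + _ _.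
apply: le_lt_trans; apply: le_measure; rewrite ?inE//.
  by apply: compact_borel.
exact: subset_closure.
Qed.

Lemma support_compact_gt0 : locally_compact [set: X] ->
  measure_support mu = [set: X] -> exists2 K : set X, compact K & (0 < mu K)%E.
Proof.
move=> lcX supp; have [K nK' [cK clK]] := lcX point I; exists K => //.
have nK : nbhs (point : X) K 
  by apply: (@filterS _ (nbhs (point : X)) _ [set x | [set: X] x -> K x]) => // x; apply.
have : measure_support mu point by rewrite supp.
move=> /(_ _ (@open_interior X K)) /(_ nK) => mu0.
apply: lt_le_trans mu0 _; apply: le_measure; rewrite ?inE//.
- by apply: open_borel; exact: open_interior.
- exact: compact_borel.
- exact: interior_subset.
Qed.

(** A compact set meets only finitely many members of a locally finite family, and
    each member, having an interior point, meets one of countably many compact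
    sets. *)
Lemma admissible_covering_countable (I : choiceType) (U : I -> set (borel X)) :
  sigma_compact X -> admissible_covering U -> countable [set: I].
Proof.
move=> [K [cK KX]] [_ lf Ui _].
have finK n : finite_set [set i | U i `&` K n !=set0].
  have lf' (x : X) : exists V : set X, nbhs x V /\
      finite_set [set i | U i `&` V !=set0].
    by have [V] := lf x; exists V.
  have [V HV] := choice lf'.
  have := cK n; rewrite compact_cover => /(_ X (K n) (fun x => interior (V x))).
  case=> [x _|x Kx|D _]; first exact: open_interior.
    by exists x => //; case: (HV x) => nV _; exact: nV.
  have := finite_fset D; set E := mkset _ => finE KD.
  have sub : [set i | U i `&` K n !=set0] `<=`
      \bigcup_(x in E) [set i | U i `&` V x !=set0].
    move=> i [z [Uiz Kz]]; have [x Ex Vz] := KD _ Kz.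
    by exists x => //; exists z; split => //; exact: interior_subset Vz.
  apply: sub_finite_set sub _.
  by apply: bigcup_finite => // x _; case: (HV x).
have -> : [set: I] = \bigcup_n [set i | U i `&` K n !=set0].
  apply/seteqP; split => // i _; have [_ _ [x /interior_subset Ux]] := Ui i.
  have : (\bigcup_n K n) x by rewrite KX.
  by move=> [n _ Kx]; exists n => //; exists x.
by apply: bigcup_countable => // n _; exact: finite_set_countable.
Qed.

End topology.

Lemma countable_coding (I : choiceType) : countable [set: I] ->
  exists (code : I -> nat) (decode : nat -> option I),
    (forall i, decode (code i) = Some i) /\
    (forall n i, decode n = Some i -> code i = n).
Proof.
move=> /countable_injP[code inj].
pose decode n := if pselect (exists i, code i = n) is left h
  then Some (projT1 (cid h)) else None.
exists code, decode; split => [i|n i].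
  rewrite /decode; case: pselect => [h|[]]; last by exists i.
  by congr Some; apply: inj; rewrite ?inE//; exact: projT2 (cid h).
rewrite /decode; case: pselect => // h [<-]; exact: projT2 (cid h).
Qed.

Lemma sigma_finite_structure {R : realType} d (T : measurableType d)
    (mu : {measure set T -> \bar R}) : sigma_finite setT mu ->
  exists m : {sigma_finite_measure set T -> \bar R},
    (m : {measure set T -> \bar R}) = mu.
Proof.
case: mu => m c sf.
(* The structures agree by eta-conversion once [mu] is in constructor form. *)
pose mk := @Measure_isSigmaFinite.Build _ _ _ (Measure.Pack c) sf.
pose m' : {sigma_finite_measure set T -> \bar R} := HB.pack m c mk.
by exists m'.
Qed.

(** * Solid quasi-Banach function spaces *)

Section solid_spaces.
Context {R : realType} {X : ptopologicalType}.
Context {mu : {measure set (borel X) -> \bar R}} {CY : R}.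
Variable Y : qbf_space mu CY.
Hypothesis solidY : solid Y.

Lemma qbf_cabs F : qbf_set Y F -> qbf_set Y (fun x => (cabs (F x))%:C%C) /\
  qnorm Y (fun x => (cabs (F x))%:C%C) = qnorm Y F.
Proof.
move=> YF; have mF := qbf_measurable YF.
have cc x : cabs (cabs (F x))%:C%C = cabs (F x).
  by rewrite cabsR ger0_norm// cabs_ge0.
have [||YaF le1] := solidY (f := fun x => (cabs (F x))%:C%C) _ YF.
- exact: cmeasurable_cabs.
- by apply: aeW => x; rewrite cc.
have [|_ le2] := solidY mF YaF; first by apply: aeW => x; rewrite cc.
by split=> //; apply/eqP; rewrite eq_le le1.
Qed.

Lemma qbfB F G : qbf_set Y F -> qbf_set Y G -> qbf_set Y (fun x => F x - G x).
Proof.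
move=> YF YG; under eq_fun do rewrite -mulN1r.
by apply: qbfD => //; exact: qbfZ.
Qed.

(** The quasi-triangle inequality for a function and zero already forces the
    constant to be at least one, unless all norms vanish; the latter is excluded
    by the indicator of a compact set of positive measure. *)
Lemma rich_quasinorm_ge1 (K : set X) : rich Y -> compact K ->
  measurable (K : set (borel X)) -> (0 < mu K)%E -> 1 <= CY.
Proof.
move=> richY cK mK muK; have YK := richY K cK.
set h := (fun x => _) in YK.
have nh0 : qnorm Y h != 0.
  apply/eqP => /(qnorm_eq0 YK)[N [mN N0 hN]].
  have : (mu K <= mu N)%E.
    apply: le_measure; rewrite ?inE// => x Kx; apply: hN => /= /(congr1 (@complex.Re R)).
    by rewrite /h /= indicE mem_set//= => /eqP; rewrite oner_eq0.
  by rewrite leNgt N0 muK.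
have := qnormD YK (qbf0 Y).
have -> : qnorm Y (fun=> 0) = 0 by apply/(qnorm_eq0 (qbf0 Y)); exact: aeW.
rewrite (_ : (fun x => h x + 0) = h); last by apply/funext => x; rewrite addr0.
have h0 : 0 < qnorm Y h by rewrite lt_def nh0 qnorm_ge0.
by rewrite addr0 -[leLHS]mul1r ler_pM2r.
Qed.

Lemma kopnorm_lt (K : borel X * borel X -> R[i]) (e : \bar R) :
  (kopnorm Y K < e)%E -> exists C : R, [/\ 0 <= C, (C%:E < e)%E, kdefined Y K &
    op_bound Y (qbf_set Y) (kact mu K) C].
Proof. by move=> /ereal_inf_lt[_ [C [C0 dK bK] <-] Ce]; exists C. Qed.

End solid_spaces.

(** * Positive kernels on a solid space *)

Section potentials.
Context {R : realType} {X : ptopologicalType}.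
Variable mu : {sigma_finite_measure set (borel X) -> \bar R}.
Context {CY : R}.
Variable Y : qbf_space mu CY.
Hypothesis solidY : solid Y.

(** Real-valued counterpart of [kact] for nonnegative data, used as a pointwise
    majorant. *)
Definition potential (k : borel X * borel X -> R) (G : borel X -> R) x : R :=
  fine (\int[mu]_y (k (x, y) * G y)%:E)%E.

Variables (k : borel X * borel X -> R) (G : borel X -> R).
Hypotheses (k_ge0 : forall p, 0 <= k p) (G_ge0 : forall y, 0 <= G y).
Hypothesis kdef : kdefined Y (fun p => (k p)%:C%C).
Hypothesis YG : qbf_set Y (fun y => (G y)%:C%C).

Lemma potential_ge0 x : 0 <= potential k G x.
Proof.
by apply: fine_ge0; apply: integral_ge0 => y _; rewrite lee_fin mulr_ge0.
Qed.

Lemma kact_potential :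
  kact mu (fun p => (k p)%:C%C) (fun y => (G y)%:C%C) =
  (fun x => (potential k G x)%:C%C).
Proof.
apply/funext => x; rewrite /kact -[RHS]cintR; congr cint.
by apply/funext => y; rewrite -rmorphM.
Qed.

Lemma potentialE : {ae mu, forall x,
  (\int[mu]_y (k (x, y) * G y)%:E)%E = (potential k G x)%:E}.
Proof.
apply: filterS (kdef YG) => x /integral_cabs_fin.
under eq_integral do rewrite cabsM !cabsR !ger0_norm//.
by move=> fx; rewrite /potential fineK.
Qed.

Lemma potential_qbf (C : R) :
  op_bound Y (qbf_set Y) (kact mu (fun p => (k p)%:C%C)) C ->
  qbf_set Y (fun x => (potential k G x)%:C%C) /\
  qnorm Y (fun x => (potential k G x)%:C%C) <=
    C * qnorm Y (fun y => (G y)%:C%C).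
Proof. by move=> /(_ _ YG); rewrite kact_potential. Qed.

End potentials.

(** * The space of reproduced functions *)

Section reproduced.
Context {R : realType} {X : ptopologicalType} {H : completeNormedModType R[i]}.
Variable mu : {sigma_finite_measure set (borel X) -> \bar R}.
Variable dot : {dot H for Num.conj}.
Variables (phi : borel X -> H) (nu : borel X -> R).
Hypotheses (hilbH : hilbert_separable dot) (frame_phi : parseval_frame mu dot phi).
Context {CY : R}.
Variable Y : qbf_space mu CY.
Hypothesis solidY : solid Y.
Hypothesis mR : cmeasurable (Rker dot phi).
Hypothesis bR : kbounded Y (Rker dot phi).
Hypothesis bRabs : kbounded Y (kabs (Rker dot phi)).
Local Notation Rk := (Rker dot phi).
Local Notation RY := (Rspace dot Y phi).

Lemma Rspace_qbf F : RY F -> qbf_set Y F.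
Proof.
move=> [mF [G YG FG]]; case: bR => _ [C /(_ _ YG)[YRG _]].
have GF : {ae mu, forall x, kact mu Rk G x = F x}.
  by apply: filterS FG => x ->.
by case: (qbf_ae YRG mF GF).
Qed.

Lemma cmeasurable_kact (K : borel X * borel X -> R[i]) F : cmeasurable K ->
  cmeasurable F -> cmeasurable (kact mu K F).
Proof.
move=> mK mF; apply: (cmeasurable_cint2 _ (f := fun p => K p * F p.2)).
apply: cmeasurableM => //; exact: cmeasurable_comp measurable_snd mF.
Qed.

(** Superpositions of the functions [Rk (_, p w)] are reproduced by the kernel,
    as each of them is; the majorant in [Y] is what makes the two integrations
    commute. *)
Lemma reproducing_family {d} {T : measurableType d}
    (m : {sigma_finite_measure set T -> \bar R})
    (S : borel X * T -> R[i]) (p : T -> X) (b : T -> R[i]) (D : borel X -> R) :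
  cmeasurable S -> (forall z w, S (z, w) = Rk (z, p w) * b w) ->
  (forall z, 0 <= D z) -> qbf_set Y (fun z => (D z)%:C%C) ->
  {ae mu, forall z, (\int[m]_w (cabs (S (z, w)))%:E <= (D z)%:E)%E} ->
  qbf_set Y (fun z => cint m (fun w => S (z, w))) /\
  {ae mu, forall x, kact mu Rk (fun z => cint m (fun w => S (z, w))) x =
                    cint m (fun w => S (x, w))}.
Proof.
move=> mS SE D0 YD SD.
have mcS := cmeasurable_cint2 m mS.
have iS : {ae mu, forall z, cintegrable m (fun w => S (z, w))}.
  apply: filterS SD => z Sz; split; first exact: cmeasurable_pair1.
  exact: le_lt_trans Sz (ltry _).
split.
  case: (solidY (f := fun z => cint m (fun w => S (z, w))) mcS YD) => //.
  apply: filterS2 iS SD => z iz Sz; rewrite -lee_fin cabsR ger0_norm//.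
  exact: le_trans (le_cabs_cint iz) Sz.
have [dRabs _] := bRabs.
apply: filterS (dRabs _ YD) => x [mx xoo].
pose f q := Rk (x, q.1) * S q.
have mRx : cmeasurable (fun z => Rk (x, z)) by exact: cmeasurable_pair1.
have mf : cmeasurable f.
  by apply: cmeasurableM => //; exact: cmeasurable_comp measurable_fst mRx.
have foo : (\int[mu]_z \int[m]_w (cabs (f (z, w)))%:E < +oo)%E.
  apply: le_lt_trans xoo; apply: ae_ge0_le_integral => //.
  - by move=> z _; apply: integral_ge0 => w _; rewrite lee_fin cabs_ge0.
  - exact: (measurable_integral2 m (emeasurable_cabs mf)).
  - by move=> z _; rewrite lee_fin cabs_ge0.
  - exact: emeasurable_cabs.
  apply: filterS SD => z Sz _.
  under eq_integral do rewrite /f /= cabsM EFinM.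
  rewrite ge0_integralZl//; last 3 first.
  - by apply: emeasurable_cabs; exact: cmeasurable_pair1.
  - by move=> w _; rewrite lee_fin cabs_ge0.
  - by rewrite lee_fin cabs_ge0.
  rewrite cabsM /kabs !cabsR ger0_norm ?cabs_ge0// ger0_norm// EFinM.
  by rewrite lee_wpmul2l// lee_fin cabs_ge0.
transitivity (cint mu (fun z => cint m (fun w => f (z, w)))).
  apply: cint_ae_eq.
  - by apply: cmeasurableM.
  - exact: cmeasurable_cint2.
  by apply: filterS iS => z iz; rewrite /f /= cintZ.
rewrite (cint_fubini mf foo); congr cint; apply/funext => w; rewrite /f /= SE.
under [X in cint mu X]eq_fun do rewrite SE mulrA mulrC.
rewrite cintZ; last exact: cintegrable_RkerM.
by rewrite Rker_reproducing// mulrC.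
Qed.

(** The case where the superposition is an integral over the space itself. *)
Lemma kact_Rker_idem G : qbf_set Y G ->
  {ae mu, forall x, kact mu Rk (kact mu Rk G) x = kact mu Rk G x}.
Proof.
move=> YG; have [YaG _] := qbf_cabs solidY YG.
have [dR [C bC]] := bRabs.
have R0 p : 0 <= cabs (Rk p) by exact: cabs_ge0.
have G0 y : 0 <= cabs (G y) by exact: cabs_ge0.
have [] := @reproducing_family _ (borel X) mu (fun q => Rk q * G q.2) id G
  (potential mu (fun p => cabs (Rk p)) (fun y => cabs (G y))).
- apply: cmeasurableM => //.
  exact: cmeasurable_comp measurable_snd (qbf_measurable YG).
- by [].
- by move=> z; exact: potential_ge0.
- by case: (potential_qbf YaG bC).
- apply: filterS (potentialE R0 G0 dR YaG) => z <-.
  by under eq_integral do rewrite cabsM.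
by [].
Qed.

(** A representative of a reproduced function is only almost everywhere equal to
    its own image, while the image is defined at every point. *)
Lemma Rspace_fix F : RY F -> {ae mu, forall x, F x = kact mu Rk F x}.
Proof.
move=> RF; have YF := Rspace_qbf RF; case: RF => mF [G YG FG].
have mG := qbf_measurable YG.
have HH : forall x, kact mu Rk F x = kact mu Rk (kact mu Rk G) x.
  move=> x; apply: cint_ae_eq.
  - by apply: cmeasurableM => //; exact: cmeasurable_pair1.
  - apply: cmeasurableM; first exact: cmeasurable_pair1.
    exact: cmeasurable_kact.
  - by apply: filterS FG => y ->.
apply: filterS2 FG (kact_Rker_idem YG) => x Fx idx.
by rewrite HH idx.
Qed.

Hypothesis nuw : is_weight nu.
Hypothesis phiH1 : forall x, in_H1 mu dot phi nu (phi x).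
Hypothesis LY : exists C : R, forall F, RY F ->
  (ess_sup mu (fun x => (cabs (F x) / nu x)%:E) <= (C * qnorm Y F)%:E)%E.

(** Point values make sense everywhere, not only almost everywhere: reproduced
    functions are bounded by a multiple of the weight, against which every row of
    the kernel is integrable. *)
Lemma Rspace_cintegrable F : RY F ->
  forall x, cintegrable mu (fun y => Rk (x, y) * F y).
Proof.
move=> RF x; have YF := Rspace_qbf RF; have mF := qbf_measurable YF.
have [C /(_ _ RF)/ess_supP Fb] := LY; set c := C * _ in Fb.
have [mnu nu1] := nuw; have [mv vnu] := phiH1 x.
have nu0 y : 0 < nu y by exact: lt_le_trans ltr01 (nu1 y).
apply: (@cintegrable_le _ _ _ _ _ (fun y =>
   `|c|%:E * (cabs (voice dot phi (phi x) y) * nu y)%:E)%E).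
- by apply: cmeasurableM => //; exact: cmeasurable_pair1.
- apply: measurable_funeM; apply/measurable_EFinP.
  by apply: measurable_funM => //; exact: measurable_cabs.
- rewrite ge0_integralZl//; first exact: lte_mul_pinfty.
  + apply/measurable_EFinP; apply: measurable_funM => //.
    exact: measurable_cabs.
  + by move=> y _; rewrite lee_fin mulr_ge0 ?cabs_ge0// ltW.
apply: filterS Fb => y; rewrite lee_fin ler_pdivrMr// => Fy.
rewrite -EFinM lee_fin cabsM (cabs_RkerC dot phi x y) -/(voice dot phi (phi x) y).
rewrite mulrCA ler_wpM2l ?cabs_ge0// (le_trans Fy)// ler_wpM2r ?ler_norm//.
exact: ltW.
Qed.

Lemma kactZD (K : borel X * borel X -> R[i]) (a : R[i]) F G x :
  cintegrable mu (fun y => K (x, y) * F y) ->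
  cintegrable mu (fun y => K (x, y) * G y) ->
  kact mu K (fun y => a * F y + G y) x = a * kact mu K F x + kact mu K G x.
Proof.
move=> iF iG; rewrite /kact -cintZ// -cintD//; last exact: cintegrableZ.
by congr cint; apply/funext => y; rewrite mulrDr mulrCA.
Qed.

Lemma RspaceZD (a : R[i]) F G : RY F -> RY G -> RY (fun x => a * F x + G x).
Proof.
move=> [mF [F' YF' FF']] [mG [G' YG' GG']]; split.
  by apply: cmeasurableD => //; exact: cmeasurableZ.
exists (fun x => a * F' x + G' x); first by apply: qbfD => //; exact: qbfZ.
have [dR _] := bR.
apply: filterS2 (filterI FF' GG') (filterI (dR _ YF') (dR _ YG')).
by move=> x [-> ->] [iF iG]; rewrite kactZD.
Qed.

End reproduced.

(** * Discretization along a sequence *)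

Section discretization.
Context {R : realType} {X : ptopologicalType} {H : completeNormedModType R[i]}.
Variable mu : {sigma_finite_measure set (borel X) -> \bar R}.
Variable dot : {dot H for Num.conj}.
Variables (phi : borel X -> H).
Hypotheses (hilbH : hilbert_separable dot) (frame_phi : parseval_frame mu dot phi).
Context {CY : R}.
Variable Y : qbf_space mu CY.
Hypotheses (CY_ge0 : 0 <= CY) (solidY : solid Y).
Hypothesis mR : cmeasurable (Rker dot phi).
Hypothesis bR : kbounded Y (Rker dot phi).
Hypothesis bRabs : kbounded Y (kabs (Rker dot phi)).
Local Notation Rk := (Rker dot phi).
Local Notation RY := (Rspace dot Y phi).
Hypothesis iRY : forall F, RY F ->
  forall x, cintegrable mu (fun y => Rk (x, y) * F y).

Variables (P_ : nat -> borel X -> R) (x_ : nat -> X).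
Hypothesis mP : forall n, measurable_fun setT (P_ n).
Hypothesis P_ge0 : forall n y, 0 <= P_ n y.
Hypothesis Psum : forall y, (\int[counting]_n (P_ n y)%:E = 1)%E.
Hypothesis Pfin : forall n, (\int[mu]_y (P_ n y)%:E < +oo)%E.

Variable o : borel X * borel X -> R.
Hypothesis mo : measurable_fun setT o.
Hypothesis o_ge0 : forall p, 0 <= o p.
Let oT p := o (p.2, p.1).
Hypothesis def_o : kdefined Y (fun p => (o p)%:C%C).
Hypothesis def_oT : kdefined Y (fun p => (oT p)%:C%C).
Variables (Co CT CA CR : R).
Hypotheses (Co_ge0 : 0 <= Co) (CR_ge0 : 0 <= CR).
Hypothesis bA : op_bound Y (qbf_set Y) (kact mu (kabs Rk)) CA.
Hypothesis bRk : op_bound Y (qbf_set Y) (kact mu Rk) CR.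
Hypothesis bo : op_bound Y (qbf_set Y) (kact mu (fun p => (o p)%:C%C)) Co.
Hypothesis bT : op_bound Y (qbf_set Y) (kact mu (fun p => (oT p)%:C%C)) CT.

Variable gam : nat -> borel X -> R[i].
Hypothesis mgam : forall n, cmeasurable (gam n).
Hypothesis gam1 : forall n y, cabs (gam n y) = 1.
Hypothesis gam_osc : {ae mu, forall y, {ae mu, forall x, forall n,
  P_ n y != 0 -> cabs (Rk (x, y) - gam n y * Rk (x, x_ n)) <= o (x, y)}}.

Local Notation c_ n := (fine (\int[mu]_y (P_ n y)%:E)%E).

Let cnt : {sigma_finite_measure set nat -> \bar R} := @counting nat R.

Let gamK n y : Num.conj (gam n y) * gam n y = 1.
Proof.
have := cabs_sqr (gam n y); rewrite gam1 expr1n.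
case: (gam n y) => a b /= E; apply: eqC => /=; last by ring.
by rewrite E; ring.
Qed.

(** The bound on the adjoint oscillation uses [gam_osc] for fixed [y], the bound on
    the sampling sum uses it for fixed [x]. *)
Let gam_osc_swap : {ae mu, forall x, {ae mu, forall y, forall n,
  P_ n y != 0 -> cabs (Rk (x, y) - gam n y * Rk (x, x_ n)) <= o (x, y)}}.
Proof.
suff : {ae mu, forall x, forall n, {ae mu, forall y,
    P_ n y != 0 -> cabs (Rk (x, y) - gam n y * Rk (x, x_ n)) <= o (x, y)}}.
  by apply: filterS => x; exact: ae_foralln.
apply: ae_foralln => n.
pose u (p : borel X * borel X) := Rk p - gam n p.2 * Rk (p.1, x_ n).
apply: (ae_ae_swap (E := [set p | P_ n p.2 != 0 -> cabs (u p) <= o p])).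
  have mu_ : measurable_fun setT (fun p => cabs (u p)).
    apply: measurable_cabs; apply: cmeasurableB => //; apply: cmeasurableM.
      exact: cmeasurable_comp measurable_snd (mgam n).
    apply: (cmeasurable_comp (h := fst) (f := fun x => Rk (x, x_ n))) => //.
    exact: (cmeasurable_Rker2 frame_phi).
  have mP2 : measurable_fun setT (fun p : borel X * borel X => P_ n p.2).
    exact: measurableT_comp (mP n) measurable_snd.
  rewrite (_ : [set p | _] =
      ((fun p => P_ n p.2 == 0) @^-1` [set true]) `|`
      ((fun p => cabs (u p) <= o p) @^-1` [set true])).
    apply: measurableU; rewrite -[X in measurable X]setTI.
      exact: (measurable_fun_eqr mP2 (measurable_cst _)).
    exact: (measurable_fun_ler mu_ mo).
  apply/seteqP; split => p /=.
    by case: eqVneq => /= [_ _|_ /(_ isT)]; [left|right].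
  by move=> [/eqP ->|//]; rewrite eqxx.
by apply: filterS gam_osc => y; apply: filterS => x; apply.
Qed.

(** The discretization operator, with the sum written as an integral for the
    counting measure. *)
Definition sampling (F : borel X -> R[i]) : borel X -> R[i] :=
  fun x => cint (@counting nat R)
    (fun n => (c_ n)%:C%C * kact mu Rk F (x_ n) * Rk (x, x_ n)).

Section one_function.
Variable F : borel X -> R[i].
Hypothesis RF : RY F.
Let t n := kact mu Rk F (x_ n).
Let YF : qbf_set Y F. Proof. exact: Rspace_qbf RF. Qed.
Let aF y := cabs (F y).
Let YaF : qbf_set Y (fun y => (aF y)%:C%C). Proof. by case: (qbf_cabs solidY YF). Qed.
Let naF : qnorm Y (fun y => (aF y)%:C%C) = qnorm Y F.
Proof. by case: (qbf_cabs solidY YF). Qed.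
Let aF_ge0 y : 0 <= aF y. Proof. exact: cabs_ge0. Qed.
Let mF : cmeasurable F. Proof. exact: qbf_measurable YF. Qed.

Let A y := fine (\int[counting]_n (cabs (t n) * P_ n y)%:E)%E.

Let A_ge0 y : 0 <= A y.
Proof.
by apply: fine_ge0; apply: integral_ge0 => n _; rewrite lee_fin mulr_ge0 ?cabs_ge0.
Qed.

Let mA : measurable_fun setT A.
Proof.
have mh : measurable_fun setT
    (fun p : borel X * nat => (cabs (t p.2) * P_ p.2 p.1)%:E).
  apply/measurable_EFinP; apply: measurable_prod_nat => n /=.
  by apply: measurable_funM.
have mi := measurable_integral2 cnt mh.
exact: (measurableT_comp (fine_measurable measurableT) mi).
Qed.

(** At [y] the function [A] is an average, with weights [P_ n y] of total mass one,
    of sampled moduli that are at most [W y]. *)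
Lemma samples_majorized (W : borel X -> R) :
  (forall y, 0 <= W y) -> qbf_set Y (fun y => (W y)%:C%C) ->
  {ae mu, forall y, forall n, P_ n y != 0 -> cabs (t n) <= W y} ->
  [/\ {ae mu, forall y, (\int[counting]_n (cabs (t n) * P_ n y)%:E = (A y)%:E)%E},
      qbf_set Y (fun y => (A y)%:C%C) &
      qnorm Y (fun y => (A y)%:C%C) <= qnorm Y (fun y => (W y)%:C%C)].
Proof.
move=> W_ge0 YW tW.
have AW : {ae mu, forall y,
    (\int[counting]_n (cabs (t n) * P_ n y)%:E <= (W y)%:E)%E}.
  apply: filterS tW => y ty.
  have -> : (W y)%:E = (\int[counting]_n ((W y)%:E * (P_ n y)%:E))%E.
    by rewrite ge0_integralZl ?Psum ?mule1 ?lee_fin// => n _; rewrite lee_fin.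
  apply: ge0_le_integral => //.
  - by move=> n _; rewrite lee_fin mulr_ge0 ?cabs_ge0.
  - move=> n _; rewrite -EFinM lee_fin; have [->|Pn] := eqVneq (P_ n y) 0.
      by rewrite !mulr0.
    by rewrite ler_wpM2r// ty.
have AE : {ae mu, forall y,
    (\int[counting]_n (cabs (t n) * P_ n y)%:E = (A y)%:E)%E}.
  apply: filterS AW => y Ay; rewrite /A fineK// ge0_fin_numE.
    exact: le_lt_trans Ay (ltry _).
  by apply: integral_ge0 => n _; rewrite lee_fin mulr_ge0 ?cabs_ge0.
have [] := solidY (f := fun y => (A y)%:C%C) _ YW; last by [].
  exact: cmeasurableR.
apply: filterS2 AE AW => y Ay; rewrite Ay lee_fin => AyW.
by rewrite !cabsR !ger0_norm.
Qed.

(** Each sample is an integral of [F] against a sampled row, so dominating these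
    rows near [y] dominates the samples taken near [y]. *)
Lemma samples_le_kernel (k : borel X * borel X -> R) (W : borel X -> R) :
  {ae mu, forall y, measurable_fun setT (fun w => k (y, w) * aF w)} ->
  (forall p, 0 <= k p) ->
  {ae mu, forall y, (\int[mu]_w (k (y, w) * aF w)%:E <= (W y)%:E)%E} ->
  {ae mu, forall y, {ae mu, forall w, forall n, P_ n y != 0 ->
     cabs (Rk (x_ n, w)) <= k (y, w)}} ->
  {ae mu, forall y, forall n, P_ n y != 0 -> cabs (t n) <= W y}.
Proof.
move=> mk k0 kW kR; apply: filterS2 (filterI mk kR) kW => y [mky ky] Wy n Pn.
rewrite -lee_fin; apply: le_trans (le_cabs_cint (iRY RF (x_ n))) _.
apply: le_trans Wy; apply: ae_ge0_le_integral => //.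
- by move=> w _; rewrite lee_fin cabs_ge0.
- by apply: emeasurable_cabs; case: (iRY RF (x_ n)).
- by move=> w _; rewrite lee_fin mulr_ge0.
- exact/measurable_EFinP.
by apply: filterS ky => w /(_ _ Pn) kw _; rewrite lee_fin cabsM ler_wpM2r ?cabs_ge0.
Qed.

Let moT : measurable_fun setT oT.
Proof. exact: (measurableT_comp mo (measurable_fun_pair measurable_snd measurable_fst)). Qed.

Let oT_ge0 p : 0 <= oT p. Proof. exact: o_ge0. Qed.

Let aR (p : borel X * borel X) := cabs (Rk p).

Let dRabs : kdefined Y (fun p => (aR p)%:C%C). Proof. by case: bRabs. Qed.

Let aR_ge0 p : 0 <= aR p. Proof. exact: cabs_ge0. Qed.

Let sampled_row x y n :
  cabs (Rk (x, y) - gam n y * Rk (x, x_ n)) <= o (x, y) ->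
  cabs (Rk (x, x_ n)) <= aR (x, y) + o (x, y).
Proof.
rewrite -[cabs (Rk (x, x_ n))]mul1r -(gam1 n y) -cabsM /aR => oy.
have -> : gam n y * Rk (x, x_ n) = Rk (x, y) - (Rk (x, y) - gam n y * Rk (x, x_ n)).
  by ring.
by rewrite (le_trans (cabsD _ _))// cabsN lerD2l.
Qed.

Let maR : measurable_fun setT aR. Proof. exact: measurable_cabs. Qed.

Let msec (k : borel X * borel X -> R) (G : borel X -> R) x :
  measurable_fun setT k -> measurable_fun setT G ->
  measurable_fun setT (fun y => (k (x, y) * G y)%:E).
Proof.
move=> mk mG; apply/measurable_EFinP; apply: measurable_funM => //.
exact: measurable_fun_pair2 mk.
Qed.

Let maF : measurable_fun setT aF. Proof. exact: measurable_cabs. Qed.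

Let potentials (G : borel X -> R) : measurable_fun setT G ->
  (forall y, 0 <= G y) -> qbf_set Y (fun y => (G y)%:C%C) ->
  forall (k : borel X * borel X -> R) C, measurable_fun setT k ->
  (forall p, 0 <= k p) -> kdefined Y (fun p => (k p)%:C%C) ->
  op_bound Y (qbf_set Y) (kact mu (fun p => (k p)%:C%C)) C ->
  [/\ {ae mu, forall x, (\int[mu]_y ((k (x, y) + aR (x, y)) * G y)%:E =
       (potential mu k G x + potential mu aR G x)%:E)%E},
     forall y, 0 <= potential mu k G y + potential mu aR G y,
     qbf_set Y (fun y => (potential mu k G y + potential mu aR G y)%:C%C) &
     qnorm Y (fun y => (potential mu k G y + potential mu aR G y)%:C%C) <=
     CY * ((C + CA) * qnorm Y (fun y => (G y)%:C%C))].
Proof.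
move=> mG G0 YG k C mk k0 dk bk.
have [Y1 n1] := potential_qbf YG bk; have [Y2 n2] := potential_qbf YG bA.
have E : (fun y => (potential mu k G y + potential mu aR G y)%:C%C) =
    (fun y => (potential mu k G y)%:C%C + (potential mu aR G y)%:C%C).
  by apply/funext => y; rewrite rmorphD.
split.
- apply: filterS2 (potentialE k0 G0 dk YG) (potentialE aR_ge0 G0 dRabs YG).
  move=> x kx ax; under eq_integral do rewrite mulrDl EFinD.
  rewrite ge0_integralD//; last 4 first.
  + by move=> y _; rewrite lee_fin mulr_ge0.
  + exact: msec.
  + by move=> y _; rewrite lee_fin mulr_ge0.
  + exact: msec.
  by rewrite kx ax.
- by move=> y; rewrite addr_ge0 ?potential_ge0.
- by rewrite E; exact: qbfD.
- rewrite E (le_trans (qnormD Y1 Y2))// ler_wpM2l// mulrDl lerD//.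
Qed.

(** A majorant of the samples that does not involve the maximal kernel. *)
Let osc_majorant y := potential mu oT aF y + potential mu aR aF y.

Lemma samples_le_osc :
  {ae mu, forall y, forall n, P_ n y != 0 -> cabs (t n) <= osc_majorant y}.
Proof.
have [Epot _ _ _] := potentials maF aF_ge0 YaF moT oT_ge0 def_oT bT.
apply: (samples_le_kernel (k := fun p => oT p + aR p)).
- apply: aeW => y; apply: measurable_funM => //.
  apply: measurable_funD; [exact: measurable_fun_pair2 moT|].
  exact: measurable_fun_pair2 maR.
- by move=> p; rewrite addr_ge0.
- by apply: filterS Epot => y ->.
apply: filterS gam_osc => y; apply: filterS => w hw n /hw /sampled_row.
by rewrite /aR (cabs_RkerC _ _ (x_ n)) (cabs_RkerC _ _ y w) addrC.
Qed.

Lemma osc_majorant_qbf : [/\ forall y, 0 <= osc_majorant y,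
  qbf_set Y (fun y => (osc_majorant y)%:C%C) &
  qnorm Y (fun y => (osc_majorant y)%:C%C) <= CY * ((CT + CA) * qnorm Y F)].
Proof.
have [_ W1 W2 W3] := potentials maF aF_ge0 YaF moT oT_ge0 def_oT bT.
by split => //; rewrite -naF.
Qed.

Let AE : {ae mu, forall y,
  (\int[counting]_n (cabs (t n) * P_ n y)%:E = (A y)%:E)%E}.
Proof.
have [W1 W2 _] := osc_majorant_qbf.
by have [] := samples_majorized W1 W2 samples_le_osc.
Qed.

Let YA : qbf_set Y (fun y => (A y)%:C%C).
Proof.
have [W1 W2 _] := osc_majorant_qbf.
by have [] := samples_majorized W1 W2 samples_le_osc.
Qed.

Let D x := potential mu o A x + potential mu aR A x.

Let term x n := (c_ n)%:C%C * t n * Rk (x, x_ n).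

Let V := sampling F.

(** Integrating [g x] over the space gives the terms of the sampling sum, and
    summing it over the indices gives the integrand to be compared with [F]. *)
Let g x (q : borel X * nat) := t q.2 * (P_ q.2 q.1)%:C%C * Rk (x, x_ q.2).

Let mg x : cmeasurable (g x).
Proof.
apply: cmeasurable_prod_nat => n; rewrite /g /=.
apply: cmeasurableM; last exact: cmeasurable_cst.
by apply: cmeasurableZ; exact: cmeasurableR.
Qed.

Let cabs_g x y n : cabs (g x (y, n)) = cabs (t n) * P_ n y * cabs (Rk (x, x_ n)).
Proof. by rewrite /g /= !cabsM cabsR ger0_norm. Qed.

Let g_le : {ae mu, forall x,
  (\int[mu]_y \int[cnt]_n (cabs (g x (y, n)))%:E <= (D x)%:E)%E}.
Proof.
have [ED _ _ _] := potentials mA A_ge0 YA mo o_ge0 def_o bo.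
apply: filterS2 ED gam_osc_swap => x <- xo.
have kA0 y : 0 <= (o (x, y) + aR (x, y)) by rewrite addr_ge0.
apply: ae_ge0_le_integral => //.
- by move=> y _; apply: integral_ge0 => n _; rewrite lee_fin cabs_ge0.
- exact: (measurable_integral2 cnt (emeasurable_cabs (mg x))).
- by move=> y _; rewrite lee_fin mulr_ge0.
- apply: (msec x (k := fun p => o p + aR p)) => //; exact: measurable_funD.
apply: filterS2 AE xo => y Ay yo _.
rewrite EFinM -Ay -ge0_integralZl//; last 2 first.
- by move=> n _; rewrite lee_fin mulr_ge0 ?cabs_ge0.
- by rewrite lee_fin.
apply: ge0_le_integral => //.
- by move=> n _; rewrite lee_fin cabs_ge0.
move=> n _; rewrite -EFinM lee_fin cabs_g mulrC.
have [->|Pn] := eqVneq (P_ n y) 0; first by rewrite !mulr0.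
rewrite ler_wpM2r ?mulr_ge0 ?cabs_ge0//.
by rewrite addrC sampled_row// yo.
Qed.

Let iP n : cintegrable mu (fun y => (P_ n y)%:C%C).
Proof.
split; first exact: cmeasurableR.
by under eq_integral do rewrite cabsR ger0_norm//.
Qed.

Let termE x n : term x n = cint mu (fun y => g x (y, n)).
Proof.
have -> : (fun y => g x (y, n)) = (fun y => (t n * Rk (x, x_ n)) * (P_ n y)%:C%C).
  by apply/funext => y; rewrite /g /= mulrAC.
by rewrite cintZ// cintR /term -mulrA mulrC.
Qed.

Let goo x : (\int[mu]_y \int[cnt]_n (cabs (g x (y, n)))%:E <= (D x)%:E)%E ->
  (\int[mu]_y \int[cnt]_n (cabs (g x (y, n)))%:E < +oo)%E.
Proof. by move=> gx; exact: le_lt_trans gx (ltry _). Qed.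

Let term_le : {ae mu, forall x,
  (\int[cnt]_n (cabs (term x n))%:E <= (D x)%:E)%E}.
Proof.
apply: filterS g_le => x gx; apply: le_trans gx.
rewrite (tonelli_cabs mu cnt (mg x)); apply: ge0_le_integral => //.
- by move=> n _; rewrite lee_fin cabs_ge0.
move=> n _; rewrite termE; apply: le_cabs_cint.
have -> : (fun y => g x (y, n)) = (fun y => (t n * Rk (x, x_ n)) * (P_ n y)%:C%C).
  by apply/funext => y; rewrite /g /= mulrAC.
exact: cintegrableZ.
Qed.

Lemma sampling_summable : {ae mu, forall x, cintegrable (@counting nat R)
  (fun n => (c_ n)%:C%C * kact mu Rk F (x_ n) * Rk (x, x_ n))}.
Proof.
apply: filterS term_le => x tx; split; first exact: cmeasurable_nat.
exact: le_lt_trans tx (ltry _).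
Qed.

Let YD : (forall x, 0 <= D x) /\ qbf_set Y (fun x => (D x)%:C%C).
Proof. by have [_ D1 D2 _] := potentials mA A_ge0 YA mo o_ge0 def_o bo. Qed.

(** The discretized function is a superposition of columns of the kernel, and
    is thus reproduced. *)
Lemma sampling_Rspace : RY (sampling F).
Proof.
have [D1 D2] := YD.
have mterm : cmeasurable (fun q : borel X * nat => term q.1 q.2).
  apply: cmeasurable_prod_nat => n; rewrite /term /=; apply: cmeasurableZ.
  exact: (cmeasurable_Rker2 frame_phi).
have [|YV RV] := @reproducing_family _ _ _ mu dot phi hilbH frame_phi _ Y solidY
  mR bRabs _ nat cnt (fun q => term q.1 q.2) x_ (fun n => (c_ n)%:C%C * t n) D
  mterm _ D1 D2 term_le.
  by move=> z n; rewrite /term /= mulrC.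
split; first exact: qbf_measurable YV.
by exists V => //; apply: filterS RV => x ->.
Qed.

(** The samples are rotated by the conjugate phases, so that near [x_ n] the step
    function [Hs] below follows [F] up to the oscillation. *)
Let h (q : borel X * nat) := Num.conj (gam q.2 q.1) * (t q.2 * (P_ q.2 q.1)%:C%C).

Let mh : cmeasurable h.
Proof.
apply: cmeasurable_prod_nat => n; rewrite /h /=; apply: cmeasurableM.
  exact: cmeasurable_conj.
by apply: cmeasurableZ; exact: cmeasurableR.
Qed.

Let cabs_h y n : cabs (h (y, n)) = cabs (t n) * P_ n y.
Proof. by rewrite /h /= !cabsM cabs_conj gam1 mul1r cabsR ger0_norm. Qed.

Let Hs y := cint cnt (fun n => h (y, n)).

Let ih : {ae mu, forall y, cintegrable cnt (fun n => h (y, n))}.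
Proof.
apply: filterS AE => y Ay; split; first exact: cmeasurable_nat.
by under eq_integral do rewrite cabs_h; rewrite Ay ltry.
Qed.

Let mHs : cmeasurable Hs.
Proof. exact: (cmeasurable_cint2 cnt mh). Qed.

Let YHs : qbf_set Y Hs.
Proof.
have [] := solidY mHs YA; last by [].
apply: filterS2 ih AE => y hy Ay; rewrite -lee_fin cabsR ger0_norm// -Ay.
apply: le_trans (le_cabs_cint hy) _.
by under eq_integral do rewrite cabs_h.
Qed.

(** Writing [F y] as an average of itself, the difference becomes an average of
    [F y - conj (gam n y) * t n], that is, of integrals of [F] against differences
    of rows; by hermitian symmetry these are differences of columns. *)
Let step_error : {ae mu, forall y, cabs (F y - Hs y) <= potential mu oT aF y}.
Proof.
have Epot := potentialE oT_ge0 aF_ge0 def_oT YaF.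
have Ffix := Rspace_fix hilbH frame_phi solidY mR bR bRabs RF.
apply: filterS2 (filterI Epot Ffix) (filterI ih gam_osc).
move=> y [By Fy] [hy oy]; rewrite -lee_fin -By.
set B := (\int[mu]_z _)%E.
have iPy : cintegrable cnt (fun n => (P_ n y)%:C%C).
  split; first exact: cmeasurable_nat.
  by under eq_integral do rewrite cabsR ger0_norm//; rewrite Psum ltry.
have -> : F y = cint cnt (fun n => F y * (P_ n y)%:C%C).
  by rewrite cintZ// cintR Psum mulr1.
rewrite -cintB//; last exact: cintegrableZ.
have iB : cintegrable cnt (fun n => F y * (P_ n y)%:C%C - h (y, n)).
  by apply: cintegrableB => //; exact: cintegrableZ.
apply: le_trans (le_cabs_cint iB) _.
have B0 : (0 <= B)%E by apply: integral_ge0 => z _; rewrite lee_fin mulr_ge0.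
have -> : B = (\int[cnt]_n (B * (P_ n y)%:E))%E.
  by rewrite ge0_integralZl ?Psum ?mule1// => n _; rewrite lee_fin.
apply: ge0_le_integral => //.
- by move=> n _; rewrite lee_fin cabs_ge0.
move=> n _.
have -> : F y * (P_ n y)%:C%C - h (y, n) =
    (F y - Num.conj (gam n y) * t n) * (P_ n y)%:C%C.
  by rewrite /h /= mulrBl mulrA.
rewrite cabsM cabsR ger0_norm// EFinM.
have [->|Pn] := eqVneq (P_ n y) 0; first by rewrite !mule0.
rewrite lee_wpmul2r ?lee_fin//.
have -> : F y - Num.conj (gam n y) * t n = cint mu (fun z =>
    Rk (y, z) * F z - Num.conj (gam n y) * (Rk (x_ n, z) * F z)).
  rewrite cintB; [|exact: iRY|by apply: cintegrableZ; exact: iRY].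
  by rewrite cintZ; [rewrite Fy|exact: iRY].
have iD := cintegrableB (iRY RF y) (cintegrableZ (Num.conj (gam n y)) (iRY RF (x_ n))).
apply: le_trans (le_cabs_cint iD) _.
apply: ae_ge0_le_integral => //.
- by move=> z _; rewrite lee_fin cabs_ge0.
- by apply: emeasurable_cabs; case: iD.
- by move=> z _; rewrite lee_fin mulr_ge0.
- exact: msec.
apply: filterS oy => z /(_ _ Pn) oz _; rewrite lee_fin.
rewrite mulrA -mulrBl cabsM ler_wpM2r ?cabs_ge0//; apply: le_trans oz.
rewrite (RkerC dot phi y z) (RkerC dot phi (x_ n) z) -rmorphM -rmorphB.
by rewrite cabs_conj.
Qed.

(** Both terms are integrals over [y] of sums over [n], compared termwise. *)
Let sum_error : {ae mu, forall x, cabs (kact mu Rk Hs x - V x) <= potential mu o A x}.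
Proof.
have Epot := potentialE o_ge0 A_ge0 def_o YA.
have [dR _] := bR.
apply: filterS2 (filterI Epot (dR _ YHs)) (filterI gam_osc_swap g_le).
move=> x [Ex iRH] [ox gx]; rewrite -lee_fin -Ex.
have VE : V x = cint mu (fun y => cint cnt (fun n => g x (y, n))).
  rewrite (cint_fubini (mg x) (goo gx)); congr cint; apply/funext => n.
  exact: termE.
have ig := cintegrable_cint2 (mg x) (goo gx).
rewrite VE /kact -cintB//.
have iD := cintegrableB iRH ig.
apply: le_trans (le_cabs_cint iD) _.
apply: ae_ge0_le_integral => //.
- by move=> y _; rewrite lee_fin cabs_ge0.
- by apply: emeasurable_cabs; case: iD.
- by move=> y _; rewrite lee_fin mulr_ge0.
- exact: msec.
apply: filterS2 (filterI ih AE) (filterI ox (ae_cintegrable_pair1 (mg x) (goo gx))).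
move=> y [hy Ay] [oy gy] _; rewrite /Hs -cintZ// -cintB//; last exact: cintegrableZ.
have iDy := cintegrableB (cintegrableZ (Rk (x, y)) hy) gy.
apply: le_trans (le_cabs_cint iDy) _.
rewrite EFinM -Ay -ge0_integralZl//; last 2 first.
- by move=> n _; rewrite lee_fin mulr_ge0 ?cabs_ge0.
- by rewrite lee_fin.
apply: ge0_le_integral => //.
- by move=> n _; rewrite lee_fin cabs_ge0.
move=> n _; rewrite -EFinM lee_fin.
have -> : Rk (x, y) * h (y, n) - g x (y, n) =
   (Num.conj (gam n y) * (Rk (x, y) - gam n y * Rk (x, x_ n))) *
   (t n * (P_ n y)%:C%C).
  rewrite /h /g /= mulrBr [_ * (gam n y * _)]mulrA gamK mul1r mulrBl.
  by congr (_ - _); [rewrite mulrA [Rk _ * _]mulrC | rewrite mulrC].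
rewrite !cabsM cabs_conj gam1 mul1r cabsR ger0_norm//.
have [->|Pn] := eqVneq (P_ n y) 0; first by rewrite !mulr0.
by rewrite ler_wpM2r ?mulr_ge0 ?cabs_ge0// oy.
Qed.

(** The error splits into the reproduction of [F - Hs] and the error of replacing
    the integral of [Hs] against the kernel by the sampling sum. The samples only
    enter the second part, through their majorant [W]. *)
Lemma sampling_error (W : borel X -> R) :
  (forall y, 0 <= W y) -> qbf_set Y (fun y => (W y)%:C%C) ->
  {ae mu, forall y, forall n, P_ n y != 0 -> cabs (t n) <= W y} ->
  qbf_set Y (fun x => F x - sampling F x) /\
  qnorm Y (fun x => F x - sampling F x) <=
    CY * (CR * (CT * qnorm Y F) + Co * qnorm Y (fun y => (W y)%:C%C)).
Proof.
move=> W1 W2 W3; have [_ _ AW] := samples_majorized W1 W2 W3.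
have YFH := qbfB YF YHs; have [_ bR'] := bRk YFH.
have [YpT npT] := potential_qbf YaF bT.
have [_ nFH] : qbf_set Y (fun y => F y - Hs y) /\ qnorm Y (fun y => F y - Hs y) <=
    qnorm Y (fun y => (potential mu oT aF y)%:C%C).
  apply: solidY YpT _; first exact: qbf_measurable YFH.
  by apply: filterS step_error => y; rewrite cabsR ger0_norm// potential_ge0.
have [YpA npA] := potential_qbf YA bo.
have [YRH _] := bRk YHs.
have YV : qbf_set Y V by exact: Rspace_qbf sampling_Rspace.
have YN2 := qbfB YRH YV; have [YN1 _] := bRk YFH.
have [_ nN2] : qbf_set Y (fun x => kact mu Rk Hs x - V x) /\
    qnorm Y (fun x => kact mu Rk Hs x - V x) <=
    qnorm Y (fun y => (potential mu o A y)%:C%C).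
  apply: solidY YpA _; first exact: qbf_measurable YN2.
  by apply: filterS sum_error => y; rewrite cabsR ger0_norm// potential_ge0.
have YFV := qbfB YF YV; split => //.
have Ffix := Rspace_fix hilbH frame_phi solidY mR bR bRabs RF.
have [dR _] := bR.
have [|_ ->] := qbf_ae (qbfD YN1 YN2) (qbf_measurable YFV).
  apply: filterS2 Ffix (dR _ YHs) => x Fx iH.
  have -> : kact mu Rk (fun y => F y - Hs y) x = kact mu Rk F x - kact mu Rk Hs x.
    rewrite /kact -cintB//; last exact: iRY.
    by congr cint; apply/funext => y; rewrite mulrBr.
  by rewrite -Fx addrA subrK.
apply: le_trans (qnormD YN1 YN2) _; rewrite ler_wpM2l// lerD//.
  rewrite (le_trans bR')// ler_wpM2l// (le_trans nFH)// (le_trans npT)//.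
  by rewrite naF.
by rewrite (le_trans nN2)// (le_trans npA)// ler_wpM2l.
Qed.

End one_function.

Lemma sampling_linear (a : R[i]) F G : RY F -> RY G ->
  {ae mu, forall x, sampling (fun y => a * F y + G y) x =
    a * sampling F x + sampling G x}.
Proof.
move=> RF RG.
apply: filterS2 (sampling_summable RF) (sampling_summable RG) => x iF iG.
rewrite /sampling -cintZ// -cintD//; last exact: cintegrableZ.
congr cint; apply/funext => n; rewrite kactZD; [|exact: iRY|exact: iRY].
by ring.
Qed.

Lemma sampling_bounded : exists C : R, forall F, RY F ->
  qnorm Y (fun x => F x - sampling F x) <= C * qnorm Y F.
Proof.
exists (CY * (CR * CT + Co * (CY * (CT + CA)))) => F RF.
have [W1 W2 W3] := osc_majorant_qbf RF.
have [_ +] := sampling_error RF W1 W2 (samples_le_osc RF).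
move=> /le_trans; apply; rewrite -mulrA ler_wpM2l// mulrDl -!mulrA lerD//.
by rewrite ler_wpM2l.
Qed.

Lemma sampling_error_kernel (k : borel X * borel X -> R) (CM : R) :
  (forall p, 0 <= k p) -> kdefined Y (fun p => (k p)%:C%C) ->
  op_bound Y (qbf_set Y) (kact mu (fun p => (k p)%:C%C)) CM ->
  {ae mu, forall y, {ae mu, forall w, forall n, P_ n y != 0 ->
     cabs (Rk (x_ n, w)) <= k (y, w)}} ->
  forall F, RY F ->
  qnorm Y (fun x => F x - sampling F x) <= CY * (CR * CT + Co * CM) * qnorm Y F.
Proof.
move=> k0 dk bk kR F RF; have YF := Rspace_qbf bR RF.
have [YaF naF] := qbf_cabs solidY YF.
have aF0 y : 0 <= cabs (F y) by exact: cabs_ge0.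
have [YW nW] := potential_qbf YaF bk.
have kW := potentialE k0 aF0 dk YaF.
have [|_] := sampling_error RF (potential_ge0 mu k0 aF0) YW.
  apply: (samples_le_kernel RF) kR => //.
    apply: filterS (dk _ YaF) => y [[mre _] _].
    by under eq_fun do rewrite -[_ * _]subr0 -[X in _ - X](mulr0 0).
  by apply: filterS kW => y ->.
move=> /le_trans; apply; rewrite -mulrA ler_wpM2l// mulrDl -!mulrA lerD//.
by rewrite ler_wpM2l// (le_trans nW)// naF.
Qed.

End discretization.

(** * Oscillation and maximal kernels *)

Section local_suprema.
Context {R : realType} {X : ptopologicalType} {H : completeNormedModType R[i]}.
Context {I : choiceType}.
Variables (dot : {dot H for Num.conj}) (phi : borel X -> H).
Variables (U : I -> set (borel X)) (Gamma : X -> X -> R[i]).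
Hypothesis coverU : \bigcup_i U i = [set: X].
Hypothesis Gamma1 : forall x y, cabs (Gamma x y) = 1.
Local Notation Rk := (Rker dot phi).

Let Qset_neq0 y : exists z, Qset U y z.
Proof.
have : (\bigcup_i U i) y by rewrite coverU.
by move=> [i _ Uiy]; exists y; exists i.
Qed.

Let fine_sup_ge0 (f : X -> R) y : (forall z, 0 <= f z) ->
  0 <= fine (ereal_sup [set (f z)%:E | z in Qset U y]).
Proof.
move=> f0; apply: fine_ge0; have [z Qz] := Qset_neq0 y.
apply: (@le_trans _ _ (f z)%:E); first by rewrite lee_fin.
by apply: ereal_sup_ubound; exists z.
Qed.

Lemma fine_osc_ge0 p : 0 <= fine (osc dot phi U Gamma p).
Proof. by apply: fine_sup_ge0 => z; exact: cabs_ge0. Qed.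

Lemma fine_Mker_ge0 p : 0 <= fine (Mker dot phi U p).
Proof. by apply: fine_sup_ge0 => z; exact: cabs_ge0. Qed.

Let fine_sup_ub (f : X -> R) y z : (forall z, 0 <= f z) -> Qset U y z ->
  (ereal_sup [set (f z)%:E | z in Qset U y] < +oo)%E ->
  f z <= fine (ereal_sup [set (f z)%:E | z in Qset U y]).
Proof.
move=> f0 Qz foo.
have fz : ((f z)%:E <= ereal_sup [set (f z)%:E | z in Qset U y])%E.
  by apply: ereal_sup_ubound; exists z.
rewrite -lee_fin fineK// ge0_fin_numE//; apply: le_trans fz.
by rewrite lee_fin.
Qed.

Lemma le_fine_osc x y z : Qset U y z -> (osc dot phi U Gamma (x, y) < +oo)%E ->
  cabs (Rk (x, y) - Gamma y z * Rk (x, z)) <= fine (osc dot phi U Gamma (x, y)).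
Proof.
move=> Qz ooo.
by apply: (fine_sup_ub (f := fun z => cabs (Rk (x, y) - Gamma y z * Rk (x, z)))) => // w;
  exact: cabs_ge0.
Qed.

(** Up to a phase the row entries near [y] differ from the one at [y] by the
    oscillation, so the maximal kernel is finite where the oscillation is. *)
Lemma le_fine_Mker x y z : Qset U y z -> (osc dot phi U Gamma (x, y) < +oo)%E ->
  cabs (Rk (z, x)) <= fine (Mker dot phi U (x, y)).
Proof.
move=> Qz ooo.
apply: (fine_sup_ub (f := fun z => cabs (Rk (z, x)))) => [w| |].
- exact: cabs_ge0.
- exact: Qz.
apply: (@le_lt_trans _ _
    (cabs (Rk (x, y)) + fine (osc dot phi U Gamma (x, y)))%:E); last exact: ltry.
apply: ub_ereal_sup => _ [w Qw <-]; rewrite lee_fin cabs_RkerC.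
rewrite -[leLHS]mul1r -(Gamma1 y w) -cabsM.
have -> : Gamma y w * Rk (x, w) = Rk (x, y) - (Rk (x, y) - Gamma y w * Rk (x, w)).
  by ring.
by rewrite (le_trans (cabsD _ _))// cabsN lerD2l; exact: le_fine_osc.
Qed.

End local_suprema.

(** * The discretization operator *)

Section main.
Context {R : realType} {X : ptopologicalType}.
Variable mu : {sigma_finite_measure set (borel X) -> \bar R}.
Context {H : completeNormedModType R[i]}.
Variable dot : {dot H for Num.conj}.
Hypothesis hilbH : hilbert_separable dot.
Variable phi : borel X -> H.
Hypothesis frame_phi : parseval_frame mu dot phi.
Variable nu : borel X -> R.
Hypothesis nuw : is_weight nu.
Hypothesis phiH1 : forall x, in_H1 mu dot phi nu (phi x).
Variables (CY : R) (Y : qbf_space mu CY).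
Hypotheses (CY_ge1 : 1 <= CY) (solidY : solid Y).
Variables (delta : R) (I : choiceType) (U : I -> set (borel X)).
Variable Gamma : X -> X -> R[i].
Hypothesis delta_gt0 : 0 < delta.
Hypothesis DY : prop_D dot Y delta phi nu U Gamma.
Hypothesis muU : forall i, (mu (U i) < +oo)%E.
Variable Phi : I -> borel X -> R.
Hypothesis PU : partition_of_unity U Phi.
Variable xs : I -> X.
Hypothesis xsU : forall i, U i (xs i).
Variables (code : I -> nat) (decode : nat -> option I).
Hypothesis codeK : forall i, decode (code i) = Some i.
Hypothesis decodeK : forall n i, decode n = Some i -> code i = n.

Local Notation Rk := (Rker dot phi).
Local Notation RY := (Rspace dot Y phi).
Local Notation Up := (Uop mu dot phi Phi xs).

(** Numbers that code no index get the zero function, so that no condition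
    on the attached point arises. *)
Let P_ n y : R := oapp (fun i => Phi i y) 0 (decode n).
Let x_ n : X := oapp xs point (decode n).

Let mP n : measurable_fun setT (P_ n).
Proof.
rewrite /P_; case: decode => [i|] /=; last exact: measurable_cst.
by case: PU => mPhi _ _ _; exact: mPhi.
Qed.

Let P_ge0 n y : 0 <= P_ n y.
Proof.
rewrite /P_; case: decode => [i|] //=.
by case: PU => _ /(_ i y)/andP[].
Qed.

Let Psum y : (\int[counting]_n (P_ n y)%:E = 1)%E.
Proof.
case: PU => _ P01 _ /(_ y) <-; rewrite (esum_counting codeK decodeK).
  by apply: eq_integral => n _; rewrite /P_; case: decode.
by move=> i; rewrite lee_fin; case/andP: (P01 i y).
Qed.

Let mU i : measurable (U i).
Proof. by case: DY => _ [_ _ Ui _] _ _ _; case: (Ui i). Qed.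

Let Phi_fin i : (\int[mu]_y (Phi i y)%:E < +oo)%E.
Proof.
case: PU => mPhi P01 suppP _.
apply: (@le_lt_trans _ _ (\int[mu]_y (\1_(U i) y)%:E)%E); last first.
  by rewrite integral_indic// setIT; exact: muU.
apply: ge0_le_integral => //.
- by move=> y _; rewrite lee_fin; case/andP: (P01 i y).
- exact/measurable_EFinP.
- by apply/measurable_EFinP; exact: measurable_indic.
move=> y _; rewrite lee_fin indicE; case/andP: (P01 i y) => P0 P1.
have [->|/suppP Uy] := eqVneq (Phi i y) 0; first by rewrite ler0n.
by rewrite mem_set.
Qed.

Let Pfin n : (\int[mu]_y (P_ n y)%:E < +oo)%E.
Proof.
rewrite /P_; case: decode => [i|] /=; first exact: Phi_fin.
by rewrite integral0 ltry.
Qed.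

Let sample_near n y : P_ n y != 0 -> Qset U y (x_ n).
Proof.
rewrite /P_ /x_; case: decode => [i|] /=; last by rewrite eqxx.
by case: PU => _ _ suppP _ /suppP Uy; exists i.
Qed.

Let o p := fine (osc dot phi U Gamma p).

Let coverU : \bigcup_i U i = [set: X]. Proof. by case: DY => _ []. Qed.

Let Gamma1 x y : cabs (Gamma x y) = 1. Proof. by case: DY. Qed.

Let o_ge0 p : 0 <= o p. Proof. exact: fine_osc_ge0. Qed.

Let mo : measurable_fun setT o.
Proof.
case: DY => _ _ _ _ /(_ _ (or_introl erefl))[_ [[[mre _] _] _] _].
exact: mre.
Qed.

Let mR : cmeasurable Rk.
Proof. by case: DY => -[[_ []]]. Qed.

Let bR : kbounded Y Rk. Proof. by case: DY => -[]. Qed.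

Let bRabs : kbounded Y (kabs Rk). Proof. by case: DY => _ _ _ []. Qed.

Let iRY F : RY F -> forall x, cintegrable mu (fun y => Rk (x, y) * F y).
Proof.
by case: DY => -[_ _ LY] _ _ _ _; exact: Rspace_cintegrable mR bR nuw phiH1 LY F.
Qed.

Let osc_fin : {ae mu, forall y, {ae mu, forall x,
  (osc dot phi U Gamma (x, y) < +oo)%E}}.
Proof.
case: DY => _ _ _ _ /(_ _ (or_intror erefl))[kf _ _].
exact: (ae_product kf).
Qed.

Let kernel_bound k : (Bnorm Y nu (ker_of k) < delta%:E)%E ->
  exists C, [/\ 0 <= C, C <= delta, kdefined Y (ker_of k) &
    op_bound Y (qbf_set Y) (kact mu (ker_of k)) C].
Proof.
rewrite /Bnorm gt_max => /andP[_ /kopnorm_lt[C [C0 Cd dk bk]]].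
by exists C; split => //; rewrite ltW.
Qed.

(** [Gamma] provides, point by point, the phases among which measurable ones are
    selected; the oscillation is replaced by its real value where it is finite. *)
Let phases : exists gam : nat -> borel X -> R[i],
  [/\ forall n, cmeasurable (gam n), forall n y, cabs (gam n y) = 1 &
  {ae mu, forall y, {ae mu, forall x, forall n,
    P_ n y != 0 -> cabs (Rk (x, y) - gam n y * Rk (x, x_ n)) <= o (x, y)}}].
Proof.
have phase n : exists gam : borel X -> R[i],
    [/\ cmeasurable gam, forall y, cabs (gam y) = 1 &
    {ae mu, forall y, P_ n y != 0 -> {ae mu, forall x,
      cabs (Rk (x, y) - gam y * Rk (x, x_ n)) <= o (x, y)}}].
  apply: (@measurable_phase _ _ _ mu Rk (fun x => Rk (x, x_ n)) o mR
    (cmeasurable_Rker2 frame_phi _) mo [set y | P_ n y != 0]).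
  apply: filterS osc_fin => y oy Pn; exists (Gamma y (x_ n)) => //.
  by apply: filterS oy => x oxy; apply: le_fine_osc => //; exact: sample_near.
have [gam Hgam] := choice phase.
exists gam; split; [by move=> n; case: (Hgam n)|by move=> n; case: (Hgam n)|].
have : {ae mu, forall y, forall n, P_ n y != 0 -> {ae mu, forall x,
    cabs (Rk (x, y) - gam n y * Rk (x, x_ n)) <= o (x, y)}}.
  by apply: ae_foralln => n; case: (Hgam n).
apply: filterS => y Hy; apply: ae_foralln => n.
have [_|Pn] := eqVneq (P_ n y) 0; first by apply: aeW.
by apply: filterS (Hy n Pn) => x.
Qed.

Let termE F x n : oapp (Uterm mu dot phi Phi xs F x) 0 (decode n) =
  (fine (\int[mu]_y (P_ n y)%:E)%E)%:C%C * kact mu Rk F (x_ n) * Rk (x, x_ n).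
Proof.
rewrite /P_ /x_; case: decode => [i|] //=.
by rewrite integral0 /= mul0r mul0r.
Qed.

Let summable F x : cintegrable (@counting nat R) (fun n =>
    (fine (\int[mu]_y (P_ n y)%:E)%E)%:C%C * kact mu Rk F (x_ n) * Rk (x, x_ n)) ->
  cabs_summable (Uterm mu dot phi Phi xs F x).
Proof.
case=> _; rewrite /cabs_summable (esum_counting codeK decodeK); last first.
  by move=> i; rewrite lee_fin cabs_ge0.
apply: le_lt_trans; rewrite le_eqVlt; apply/orP; left; apply/eqP.
apply: eq_integral => n _; rewrite -termE; case: decode => [i|] //.
by rewrite /oapp cabs0.
Qed.

Let Up_sampling F x : cabs_summable (Uterm mu dot phi Phi xs F x) ->
  Up F x = sampling mu dot phi P_ x_ F x.
Proof.
move=> /(csum_counting codeK decodeK)[_]; rewrite /Uop => ->.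
by congr cint; apply/funext => n; exact: termE.
Qed.

Let mUp F : cmeasurable (Up F).
Proof.
apply: (cmeasurable_csum codeK decodeK) => i; apply: cmeasurableZ.
exact: (cmeasurable_Rker2 frame_phi).
Qed.

(** The bounds are first proved for every admissible pair of constants for the two
    kernels; the norms are then reached by taking infima. *)
Theorem discretization_operator :
  [/\ Uop_defined dot Y phi Phi xs, bounded_operator Y RY Up &
      (opnorm Y RY (fun F x => F x - Up F x)%R
       <= delta%:E * (kopnorm Y Rk +
                      kopnorm Y (ker_of (ker_adj (Mker dot phi U)))) * CY%:E)%E].
Proof.
have CY0 : 0 <= CY by exact: le_trans ler01 CY_ge1.
have [gam [mgam gam1 gam_osc]] := phases.
have [_ _ _ _ Dk] := DY.
have [_ _ /kernel_bound[Co [Co0 Cod def_o bo]]] := Dk _ (or_introl erefl).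
have [_ _ /kernel_bound[CT [CT0 CTd def_oT bT]]] := Dk _ (or_intror erefl).
have [_ [CA bA]] := bRabs.
have [_ [CR' bRk']] := bR.
(* A bound must be nonnegative to count for the operator norm. *)
pose CR := Num.max CR' 0.
have CR0 : 0 <= CR by rewrite le_max lexx orbT.
have bRk : op_bound Y (qbf_set Y) (kact mu Rk) CR.
  move=> F YF; have [YRF nRF] := bRk' _ YF; split => //.
  by rewrite (le_trans nRF)// ler_wpM2r ?qnorm_ge0// le_max lexx.
have sumF F : RY F -> {ae mu, forall x, cabs_summable (Uterm mu dot phi Phi xs F x)}.
  move=> RF; have := sampling_summable frame_phi CY0 solidY mR bR bRabs iRY
    mP P_ge0 Psum Pfin mo o_ge0 def_o def_oT bA bo bT mgam gam1 gam_osc RF.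
  by apply: filterS => x; exact: summable.
have UpE F : RY F -> {ae mu, forall x, Up F x = sampling mu dot phi P_ x_ F x}.
  by move=> /sumF; apply: filterS => x; exact: Up_sampling.
have RUp F : RY F -> RY (Up F).
  move=> RF; split; first exact: mUp.
  have [_ [G YG VG]] := sampling_Rspace hilbH frame_phi CY0 solidY mR bR bRabs iRY
    mP P_ge0 Psum Pfin mo o_ge0 def_o def_oT bA bo bT mgam gam1 gam_osc RF.
  by exists G => //; apply: filterS2 (UpE _ RF) VG => x -> ->.
have Rsub F : RY F -> RY (fun x => F x - Up F x).
  move=> RF; have := RspaceZD bR (-1) (RUp _ RF) RF.
  by under eq_fun do rewrite mulN1r addrC.
have nsub F : RY F -> qnorm Y (fun x => F x - Up F x) =
    qnorm Y (fun x => F x - sampling mu dot phi P_ x_ F x).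
  move=> RF; have YF := Rspace_qbf bR RF.
  have YFU := Rspace_qbf bR (Rsub _ RF).
  have RV := sampling_Rspace hilbH frame_phi CY0 solidY mR bR bRabs iRY
    mP P_ge0 Psum Pfin mo o_ge0 def_o def_oT bA bo bT mgam gam1 gam_osc RF.
  have mFV : cmeasurable (fun x => F x - sampling mu dot phi P_ x_ F x).
    by apply: cmeasurableB; [exact: qbf_measurable YF|case: RV].
  have [|_ ->//] := qbf_ae YFU mFV.
  by apply: filterS (UpE _ RF) => x ->.
split.
- move=> F RF; split => //; last exact: sumF.
  by move=> i; exact: iRY.
- split.
    move=> a F G RF RG.
    have := sampling_linear frame_phi CY0 solidY mR bR bRabs iRY
      mP P_ge0 Psum Pfin mo o_ge0 def_o def_oT bA bo bT mgam gam1 gam_osc a RF RG.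
    have := UpE _ (RspaceZD bR a RF RG).
    apply: filterS3 (filterI (UpE _ RF) (UpE _ RG)).
    by move=> x [-> ->] -> ->.
  have [C bC] := sampling_bounded hilbH frame_phi CY0 solidY mR bR bRabs iRY
    mP P_ge0 Psum Pfin mo o_ge0 def_o def_oT Co0 CR0 bA bRk bo bT mgam gam1 gam_osc.
  exists (CY * (1 + C)) => F RF; split; first exact: RUp.
  have YF := Rspace_qbf bR RF; have YFU := Rspace_qbf bR (Rsub _ RF).
  have -> : Up F = (fun x => F x + -1 * (F x - Up F x)).
    by apply/funext => x; rewrite mulN1r opprB addrC subrK.
  rewrite (le_trans (qnormD YF (qbfZ (-1) YFU)))// qnormZ//.
  rewrite cabsN cabs1 mul1r -mulrA ler_wpM2l// mulrDl mul1r lerD2l.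
  by rewrite nsub// bC.
have opn CR1 CM : 0 <= CR1 -> op_bound Y (qbf_set Y) (kact mu Rk) CR1 -> 0 <= CM ->
    kdefined Y (ker_of (ker_adj (Mker dot phi U))) ->
    op_bound Y (qbf_set Y) (kact mu (ker_of (ker_adj (Mker dot phi U)))) CM ->
    (opnorm Y RY (fun F x => F x - Up F x)%R <= (delta * (CR1 + CM) * CY)%:E)%E.
  move=> CR10 bCR1 CM0 dM bM.
  apply: ereal_inf_lbound; exists (delta * (CR1 + CM) * CY) => //; split.
    by rewrite !mulr_ge0 ?addr_ge0// ltW.
  move=> F RF; split; first exact: Rsub.
  rewrite nsub//.
  have M0 p : 0 <= fine (ker_adj (Mker dot phi U) p) by exact: fine_Mker_ge0.
  have MR : {ae mu, forall y, {ae mu, forall w, forall n, P_ n y != 0 ->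
      cabs (Rk (x_ n, w)) <= fine (ker_adj (Mker dot phi U) (y, w))}}.
    apply: filterS osc_fin => y; apply: filterS => w ow n /sample_near Qn.
    exact: (le_fine_Mker Gamma1 Qn ow).
  have := sampling_error_kernel hilbH frame_phi CY0 solidY mR bR bRabs iRY
    mP P_ge0 Psum Pfin mo o_ge0 def_o def_oT Co0 CR10 bA bCR1 bo bT mgam gam1 gam_osc
    M0 dM bM MR RF.
  move=> /le_trans; apply; rewrite ler_wpM2r ?qnorm_ge0//; first exact: Rspace_qbf bR F RF.
  rewrite mulrC ler_wpM2r// mulrDr lerD// [leLHS]mulrC.
    by rewrite ler_wpM2r.
  by rewrite mulrC ler_wpM2r.
have k0 K : (0 <= kopnorm Y K)%E.
  by apply: le_ereal_inf_tmp => _ [C [C0 _ _] <-]; rewrite lee_fin.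
(* If the maximal kernel does not act boundedly, the bound is infinite, the
   constant [CY] being positive. *)
have [Moo|Mfin] := eqVneq (kopnorm Y (ker_of (ker_adj (Mker dot phi U)))) +oo%E.
  rewrite Moo addey; last by rewrite gt_eqF// (lt_le_trans (ltNyr 0)).
  rewrite gt0_muley ?lte_fin// gt0_mulye ?leey// lte_fin.
  exact: lt_le_trans ltr01 CY_ge1.
have Rfin : kopnorm Y Rk \is a fin_num.
  rewrite ge0_fin_numE//; apply: le_lt_trans (ltry CR).
  by apply: ereal_inf_lbound; exists CR => //; split => //; case: bR.
have {}Mfin : kopnorm Y (ker_of (ker_adj (Mker dot phi U))) \is a fin_num.
  by rewrite ge0_fin_numE// lt_neqAle Mfin leey.
set a := fine (kopnorm Y Rk).
set b := fine (kopnorm Y (ker_of (ker_adj (Mker dot phi U)))).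
have aE : kopnorm Y Rk = a%:E by rewrite fineK.
have bE : kopnorm Y (ker_of (ker_adj (Mker dot phi U))) = b%:E by rewrite fineK.
rewrite aE bE -EFinD -!EFinM; apply/lee_addgt0Pr => e e0.
have dC : 0 < 2 * delta * CY.
  by rewrite !mulr_gt0// (lt_le_trans ltr01 CY_ge1).
(* Both norms are approached within [e'], which costs [2 * delta * CY * e' = e]. *)
pose e' := e / (2 * delta * CY).
have e'0 : 0 < e' by rewrite divr_gt0.
have [|C1 [C10 C1a _ bC1]] := @kopnorm_lt _ _ _ _ Y Rk (a + e')%:E.
  by rewrite aE lte_fin ltrDl.
have [|C2 [C20 C2b dC2 bC2]] := @kopnorm_lt _ _ _ _ Y
    (ker_of (ker_adj (Mker dot phi U))) (b + e')%:E.
  by rewrite bE lte_fin ltrDl.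
apply: le_trans (opn _ _ C10 bC1 C20 dC2 bC2) _.
rewrite -EFinD lee_fin.
have -> : delta * (a + b) * CY + e = delta * ((a + e') + (b + e')) * CY.
  have -> : e = e' * (2 * delta * CY) by rewrite /e' divfK// gt_eqF.
  by ring.
rewrite ler_wpM2r// ler_wpM2l ?(ltW delta_gt0)// lerD// ltW//.
Qed.

End main.

Theorem lemma2p47 (R : realType)
    (X : ptopologicalType) (mu : {measure set (borel X) -> \bar R})
    (hausX : hausdorff_space X) (lcX : locally_compact [set: X])
    (scX : sigma_compact X)
    (radonmu : radon mu) (suppmu : measure_support mu = [set: X])
    (H : completeNormedModType R[i]) (dot : {dot H for Num.conj})
    (hilbH : hilbert_separable dot)
    (phi : borel X -> H) (frame_phi : parseval_frame mu dot phi)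
    (nu : borel X -> R) (nuw : is_weight nu)
    (phiH1 : forall x, in_H1 mu dot phi nu (phi x))
    (CY : R) (Y : qbf_space mu CY) (richY : rich Y) (solidY : solid Y)
    (delta : R) (delta_gt0 : 0 < delta)
    (I : choiceType) (U : I -> set (borel X)) (Gamma : X -> X -> R[i])
    (DY : prop_D dot Y delta phi nu U Gamma)
    (Phi : I -> borel X -> R) (PU : partition_of_unity U Phi)
    (xs : I -> X) (xsU : forall i, U i (xs i)) :
  [/\ Uop_defined dot Y phi Phi xs,
      bounded_operator Y (Rspace dot Y phi) (Uop mu dot phi Phi xs) &
      (opnorm Y (Rspace dot Y phi) (fun F x => F x - Uop mu dot phi Phi xs F x)%R
       <= delta%:E * (kopnorm Y (Rker dot phi) +
                      kopnorm Y (ker_of (ker_adj (Mker dot phi U)))) * CY%:E)%E].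
Proof.
have [_ cov _ _ _] := DY.
have sf := radon_sigma_finite hausX radonmu scX.
have [m mE] := sigma_finite_structure sf; subst mu.
have [code [decode [codeK decodeK]]] :=
  countable_coding (admissible_covering_countable scX cov).
have [K cK K0] := support_compact_gt0 hausX lcX suppmu.
have CY1 := rich_quasinorm_ge1 richY cK (compact_borel hausX cK) K0.
have muU i : (m (U i) < +oo)%E.
  have [_ _ Ui _] := cov; have [mU pU _] := Ui i.
  exact: (radon_precompact hausX radonmu mU pU).
exact: (discretization_operator hilbH frame_phi nuw phiH1 CY1 solidY delta_gt0 DY muU PU
  xsU codeK decodeK).
Qed.
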